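(* Every hyperbolic uniform disk graph with radius $r$ on $n$ vertices has tree-independence number $\mathcal{O}\big(\sqrt{\tfrac{r}{\tanh r}}\cdot\sqrt{n}\big)$. A tree decomposition witnessing this can be computed in $\mathsf{poly}(n)$ time.
   Context: All graphs are finite and simple; $\alpha$ is the independence number. For $r>0$, a hyperbolic uniform disk graph with radius $r$ is the intersection graph of a finite collection of closed disks of the same radius $r$ in the hyperbolic plane $\mathbb{H}^2$ of curvature $-1$ (vertices are the disks, two distinct ones adjacent iff they intersect). The implicit constant is absolute (independent of $r$ and $n$). For the algorithmic part, $G$ is given together with a geometric realization consisting of the polar coordinates of the disk centers (with respect to a pole $o$ and a polar axis, a point $p$ is given by its hyperbolic distance from $o$ and its angle $\theta(p)\in[0,2\pi)$ from the polar axis), and it is assumed that for a disk $O$, computing $\inf_{x\in O}\theta(x)$ and $\sup_{x\in O}\theta(x)$ takes constant time. A tree decomposition of $G$ is a pair $(T,\{X_t\}_{t\in V(T)})$ with $T$ a tree and bags $X_t\subseteq V(G)$ such that every vertex is in some bag, both endpoints of every edge lie in a common bag, and for each $u\in V(G)$ the nodes $t$ with $u\in X_t$ induce a connected subgraph of $T$. Its independence number is $\max_t\alpha(G[X_t])$; the tree-independence number of $G$ is the minimum independence number of a tree decomposition of $G$. *)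

(* Defs.v *)
From mathcomp Require Import all_boot all_order all_algebra.
From mathcomp Require Import boolp classical_sets reals sequences exp trigo.
Set Implicit Arguments.
Unset Strict Implicit.
Unset Printing Implicit Defensive.
Import Order.TTheory GRing.Theory Num.Theory.
Local Open Scope ring_scope.

Definition stable (V : finType) (G : rel V) (S : {set V}) : bool :=
  [forall u in S, forall v in S, ~~ G u v].

(* The independence number of the induced subgraph G[X]. *)
Definition alpha (V : finType) (G : rel V) (X : {set V}) : nat :=
  \max_(S : {set V} | (S \subset X) && stable G S) #|S|.

Definition connected_in (T : finType) (E : rel T) (A : {set T}) : Prop :=
  forall s t, s \in A -> t \in A ->
    connect [rel x y | [&& E x y, x \in A & y \in A]] s t.

Definition is_tree (T : finType) (E : rel T) : Prop :=
  [/\ symmetric E, irreflexive E, (0 < #|T|)%N,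
      connected_in E [set: T] &
      forall c : seq T, (2 < size c)%N -> ~~ (cycle E c && uniq c)].

Definition is_treedec (V : finType) (G : rel V)
    (T : finType) (E : rel T) (X : T -> {set V}) : Prop :=
  [/\ is_tree E,
      forall v, exists t, v \in X t,
      forall u v, G u v -> exists t, (u \in X t) && (v \in X t) &
      forall u, connected_in E [set t | u \in X t]].

Definition treedec_alpha (V : finType) (G : rel V)
    (T : finType) (X : T -> {set V}) : nat :=
  \max_(t : T) alpha G (X t).

Definition has_treedec_alpha (V : finType) (G : rel V) (k : nat) : Prop :=
  exists (T : finType) (E : rel T) (X : T -> {set V}),
    is_treedec G E X /\ treedec_alpha G X = k.

Lemma ex_treedec_alpha (V : finType) (G : rel V) :
  exists k, `[< has_treedec_alpha G k >].
Proof.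
exists (treedec_alpha G (fun _ : unit => [set: V])); apply/asboolP.
exists unit, (fun _ _ => false), (fun=> [set: V]); split=> //; split.
- split=> //; first by rewrite card_unit.
  + by move=> [] [] _ _; apply: connect0.
  + by case=> [|x [|y s]].
- by move=> v; exists tt; rewrite inE.
- by move=> u v _; exists tt; rewrite !inE.
- by move=> u [] [] _ _; apply: connect0.
Qed.

Definition treealpha (V : finType) (G : rel V) : nat :=
  ex_minn (ex_treedec_alpha G).

Section Hyperbolic.
Variable R : realType.
Implicit Types (x r : R).

Definition sinh x : R := (expR x - expR (- x)) / 2.
Definition cosh x : R := (expR x + expR (- x)) / 2.
Definition tanh x : R := sinh x / cosh x.
Definition arcosh x : R := ln (x + Num.sqrt (x ^+ 2 - 1)).

(* Hyperboloid model of the plane of curvature -1: the upper sheet of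
   t^2 = 1 + x^2 + y^2, each point being given by its coordinates x, y. *)
Record h2 := H2 { h2x : R; h2y : R }.

Definition h2t (p : h2) : R := Num.sqrt (1 + h2x p ^+ 2 + h2y p ^+ 2).

Definition hdist (p q : h2) : R :=
  arcosh (h2t p * h2t q - h2x p * h2x q - h2y p * h2y q).

Definition pole : h2 := H2 0 0.

(* The angle in [0, 2 pi[ from the polar axis, which is the ray
   {y = 0, x >= 0}.  At the pole, where the angle is undefined, we use 0. *)
Definition theta (p : h2) : R :=
  let a := acos (h2x p / Num.sqrt (h2x p ^+ 2 + h2y p ^+ 2)) in
  if (h2x p == 0) && (h2y p == 0) then 0
  else if 0 <= h2y p then a else 2 * pi - a.

Definition disk r (c : h2) : set h2 := [set p | hdist p c <= r].

(* G is the intersection graph of the disks of radius r centered at c v. *)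
Definition realizes r (V : finType) (G : rel V) (c : V -> h2) : Prop :=
  forall u v, G u v <->
    u <> v /\ (exists p, disk r (c u) p /\ disk r (c v) p).

Definition hyperbolic_udg r (V : finType) (G : rel V) : Prop :=
  exists c : V -> h2, realizes r G c.

End Hyperbolic.

(* A real random access machine.

    Programs are finite and uniform in the input.  The memory consists of
    natural number arrays and real arrays, all initially zero; a cell is
    addressed by the name of its array and two computed indices.  Integers
    support only addition, (truncated) subtraction and comparison, so that
    unit cost is polynomially related to bit cost; reals support exact field
    operations and comparison, but no rounding.  Each assignment and each test
    costs one unit: the expressions of a fixed program have bounded size. *)

Inductive nexp :=
  | NConst of nat
  | NSize                          (* the number of vertices *)
  | NLoad of nat & nexp & nexp
  | NAdd of nexp & nexp
  | NSub of nexp & nexp.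

Inductive rexp :=
  | RNat of nexp
  | RLoad of nat & nexp & nexp
  | RAdd of rexp & rexp
  | RSub of rexp & rexp
  | RMul of rexp & rexp
  | RDiv of rexp & rexp
  | RRadius                        (* the common radius r *)
  | RDist of nexp                  (* radial coordinate of the i-th center *)
  | RAngle of nexp                 (* angular coordinate of the i-th center *)
  | RInfAngle of nexp              (* infimum of theta over the i-th disk *)
  | RSupAngle of nexp.             (* supremum of theta over the i-th disk *)

Inductive bexp :=
  | BNLe of nexp & nexp
  | BRLe of rexp & rexp
  | BAdj of nexp & nexp            (* adjacency in the input graph *)
  | BNot of bexp
  | BAnd of bexp & bexp.

Inductive cmd :=
  | Skip
  | NStore of nat & nexp & nexp & nexp    (* array, indices, value *)
  | RStore of nat & nexp & nexp & rexp
  | Seq of cmd & cmd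
  | If of bexp & cmd & cmd
  | While of bexp & cmd.

Section Machine.
Variable R : realType.

(* Read-only input; every query takes constant time.  In particular the
   extremal angles of a disk are provided by an oracle. *)
Record input := Input {
  in_size : nat;
  in_adj : nat -> nat -> bool;
  in_radius : R;
  in_dist : nat -> R;
  in_angle : nat -> R;
  in_inf : nat -> R;
  in_sup : nat -> R }.

(* Queries outside the range of vertices are answered by 0 and false. *)
Definition query n (A : Type) (a : A) (f : 'I_n -> A) (i : nat) : A :=
  oapp f a (insub i).

Definition encode (r : R) (n : nat) (G : rel 'I_n) (c : 'I_n -> h2 R) :=
  {| in_size := n;
     in_adj := fun i j => query false (fun u => query false (G u) j) i;
     in_radius := r;
     in_dist := query 0 (fun v => hdist (@pole R) (c v));
     in_angle := query 0 (fun v => theta (c v));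
     in_inf := query 0 (fun v => inf (image (disk r (c v)) (@theta R)));
     in_sup := query 0 (fun v => sup (image (disk r (c v)) (@theta R))) |}.

Record state := State {
  nmem : nat -> nat -> nat -> nat;
  rmem : nat -> nat -> nat -> R }.

Definition init : state := State (fun _ _ _ => 0%N) (fun _ _ _ => 0).

Definition update (A : Type) (m : nat -> nat -> nat -> A) (a i j : nat) (x : A) :=
  fun a' i' j' => if [&& a' == a, i' == i & j' == j] then x else m a' i' j'.

Variable I : input.

Fixpoint neval (s : state) (e : nexp) : nat :=
  match e with
  | NConst k => k
  | NSize => in_size I
  | NLoad a i j => nmem s a (neval s i) (neval s j)
  | NAdd e1 e2 => (neval s e1 + neval s e2)%N
  | NSub e1 e2 => (neval s e1 - neval s e2)%N
  end.

Fixpoint reval (s : state) (e : rexp) : R :=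
  match e with
  | RNat e1 => (neval s e1)%:R
  | RLoad a i j => rmem s a (neval s i) (neval s j)
  | RAdd e1 e2 => reval s e1 + reval s e2
  | RSub e1 e2 => reval s e1 - reval s e2
  | RMul e1 e2 => reval s e1 * reval s e2
  | RDiv e1 e2 => reval s e1 / reval s e2
  | RRadius => in_radius I
  | RDist i => in_dist I (neval s i)
  | RAngle i => in_angle I (neval s i)
  | RInfAngle i => in_inf I (neval s i)
  | RSupAngle i => in_sup I (neval s i)
  end.

Fixpoint beval (s : state) (b : bexp) : bool :=
  match b with
  | BNLe e1 e2 => (neval s e1 <= neval s e2)%N
  | BRLe e1 e2 => reval s e1 <= reval s e2
  | BAdj i j => in_adj I (neval s i) (neval s j)
  | BNot b1 => ~~ beval s b1
  | BAnd b1 b2 => beval s b1 && beval s b2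
  end.

Definition nstore (s : state) a i j e : state :=
  State (update (nmem s) a (neval s i) (neval s j) (neval s e)) (rmem s).

Definition rstore (s : state) a i j e : state :=
  State (nmem s) (update (rmem s) a (neval s i) (neval s j) (reval s e)).

(* [exec c s s' k]: started in s, the program c halts in s' after k steps.
   The rules are deterministic. *)
Inductive exec : cmd -> state -> state -> nat -> Prop :=
  | ExecSkip s : exec Skip s s 1
  | ExecNStore s a i j e : exec (NStore a i j e) s (nstore s a i j e) 1
  | ExecRStore s a i j e : exec (RStore a i j e) s (rstore s a i j e) 1
  | ExecSeq c1 c2 s1 s2 s3 k1 k2 :
      exec c1 s1 s2 k1 -> exec c2 s2 s3 k2 -> exec (Seq c1 c2) s1 s3 (k1 + k2)
  | ExecIf b c1 c2 s s' k :
      exec (if beval s b then c1 else c2) s s' k -> exec (If b c1 c2) s s' k.+1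
  | ExecWhileF b c s : ~~ beval s b -> exec (While b c) s s 1
  | ExecWhileT b c s1 s2 s3 k1 k2 :
      beval s1 b -> exec c s1 s2 k1 -> exec (While b c) s2 s3 k2 ->
      exec (While b c) s1 s3 (k1 + k2).+1.

End Machine.

(* Output convention: cell (0, 0) of array 0 holds the number m of nodes,
   array 1 is the adjacency matrix of the tree on {0, ..., m - 1}, and array 2
   is the node-vertex incidence matrix of the bags. *)
Definition out_size (R : realType) (s : state R) : nat := nmem s 0 0 0.

Definition out_tree (R : realType) (s : state R) : rel 'I_(out_size s) :=
  fun i j => nmem s 1 i j != 0%N.

Definition out_bag (R : realType) (n : nat) (s : state R) :
    'I_(out_size s) -> {set 'I_n} :=
  fun i => [set v : 'I_n | nmem s 2 i v != 0%N].
Arguments out_tree {R} s _ _.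
Arguments out_bag {R} n s _.

(* Main.v *)
(** Proof idea.  Group the vertices greedily into layers, by the distance of
    their centers to the pole, so that a layer is less than 2r wide and only
    vertices in consecutive layers can be adjacent.  With M about
    sqrt(n / (1 + r)), some residue class of layers modulo M contains at most
    n / M vertices; these are put into every bag, which leaves blocks of fewer
    than M layers.  Within a block, sweep a ray around the pole: the sets of
    disks whose angular interval contains a given angle form a path
    decomposition, and the decompositions of the blocks are concatenated.

    A ray meets only O(1 + r) pairwise disjoint disks of one layer.  Indeed the
    relevant part of the ray has length O(r), and a disk of radius r that meets
    an interval of length min(r, 1) / 8 of a geodesic contains one of four
    points: an endpoint of the interval or a point at distance min(r, 1) / 4 on
    either side of it.  Hence a bag has independence number at most
    n / M + O(M (1 + r)) = O(sqrt ((1 + r) n)), and 1 + r <= 3 r / tanh r. *)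
Require Import Defs.
From mathcomp Require Import all_boot all_order all_algebra.
From mathcomp Require Import boolp classical_sets reals sequences exp trigo.
From mathcomp Require Import ring lra zify.
Set Implicit Arguments.
Unset Strict Implicit.
Unset Printing Implicit Defensive.
Import Order.TTheory GRing.Theory Num.Theory.
Local Open Scope ring_scope.

(** The angle jumps at the polar axis: a disk that crosses the axis without containing the pole gets
    an angular interval as wide as [[0, 2 pi]] although it meets few rays. Enlarging intervals keeps
    the decomposition valid, so the price appears only in the independence bound: a disk in the bag
    of angle phi may meet the ray of angle 0 instead of the ray phi. Extremal angles that are not
    attained cost two more rays, so four rays are charged per bag. Layers start at the radial
    coordinate of an actual vertex rather than at multiples of 2r. Every round then absorbs a
    vertex, so n rounds suffice however far out the disks lie, and the machine needs no rounding.
    Both halves of the result come from one program: the bound on its output also gives the bound on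
    the tree-independence number. *)

Section HyperbolicFunctions.
Context {R : realType}.
Implicit Types (x y r X : R).

Lemma coshN x : cosh (- x) = cosh x.
Proof. by rewrite /cosh opprK addrC. Qed.

Lemma sinhN x : sinh (- x) = - sinh x.
Proof. by rewrite /sinh opprK -mulNr opprB. Qed.

Lemma cosh_sqr x : cosh x ^+ 2 = 1 + sinh x ^+ 2.
Proof.
rewrite /cosh /sinh; have := expRxMexpNx_1 x.
move: (expR x) (expR (- x)) => a b ab.
have -> : ((a + b) / 2) ^+ 2 = a * b + ((a - b) / 2) ^+ 2 by field.
by rewrite ab.
Qed.

Lemma coshB x y : cosh (x - y) = cosh x * cosh y - sinh x * sinh y.
Proof. by rewrite /cosh /sinh opprB !expRD; field. Qed.

Lemma cosh_norm x : cosh `|x| = cosh x.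
Proof. by case: (ltrgt0P x) => [||->] //; rewrite coshN. Qed.

Lemma cosh_ge1 x : 1 <= cosh x.
Proof.
rewrite /cosh; have := expRxMexpNx_1 x; have := expR_ge0 (- x).
move: (expR x) (expR (- x)) => a b b0 ab.
have : 0 <= b * (a - 1) ^+ 2 by rewrite mulr_ge0 ?sqr_ge0.
have -> : b * (a - 1) ^+ 2 = a * (a * b) - 2 * (a * b) + b by ring.
by rewrite ab; lra.
Qed.

Lemma cosh_gt0 x : 0 < cosh x.
Proof. exact: lt_le_trans (cosh_ge1 x). Qed.

Lemma cosh_lt x y : (cosh x < cosh y) = (`|x| < `|y|).
Proof.
have H (a b : R) : 0 <= a -> a < b -> cosh a < cosh b.
  move=> a0 ab; rewrite /cosh.
  have := expRxMexpNx_1 a; have := expRxMexpNx_1 b.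
  have : 1 <= expR a by rewrite -expR0 ler_expR.
  have : expR a < expR b by rewrite ltr_expR.
  move: (expR a) (expR b) (expR (- a)) (expR (- b)) => A B A' B' AB A1 BB AA.
  have A'0 : 0 < A' by nra.
  have B'0 : 0 < B' by nra.
  (* With [A' = 1 / A] and [B' = 1 / B] the difference factors, and both factors are positive. *)
  have : B + B' - A - A' = (B - A) * (1 - A' * B').
    have -> : (B - A) * (1 - A' * B') = B - A' * (B * B') - A + A * A' * B' by ring.
    by rewrite BB AA; ring.
  have : A' <= 1 by nra.
  have : B' < 1 by nra.
  by nra.
rewrite -(cosh_norm x) -(cosh_norm y).
case: (ltrgtP `|x| `|y|) => [xy|yx|->]; last by rewrite ltxx.
  by apply: H.
by apply/negbTE; rewrite -leNgt ltW // H.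
Qed.

Lemma cosh_le x y : (cosh x <= cosh y) = (`|x| <= `|y|).
Proof. by rewrite !leNgt cosh_lt. Qed.

Lemma sinh_ge0 x : 0 <= x -> 0 <= sinh x.
Proof. by move=> x0; rewrite /sinh divr_ge0// subr_ge0 ler_expR; lra. Qed.

Lemma sinh_surj X : exists x, sinh x = X.
Proof.
pose Q := Num.sqrt (X ^+ 2 + 1).
have Q2 : Q ^+ 2 = X ^+ 2 + 1 by rewrite sqr_sqrtr //; nra.
have Q0 : 0 <= Q by exact: sqrtr_ge0.
have XQ : 0 < X + Q by nra.
exists (ln (X + Q)); rewrite /sinh expRN lnK ?posrE //.
have -> : (X + Q)^-1 = Q - X.
  apply: (mulfI (lt0r_neq0 XQ)); rewrite divff ?lt0r_neq0 //; nra.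
by field.
Qed.

Lemma sinh_surj_ge0 X : 0 <= X -> exists2 x, 0 <= x & sinh x = X.
Proof.
move=> X0; have [x xX] := sinh_surj X.
have [x0|x0] := leP 0 x; first by exists x.
have := @sinh_ge0 (- x); rewrite sinhN => /(_ _)/wrap[]; first lra.
by exists (- x); rewrite ?sinhN; lra.
Qed.

Lemma arcosh_ge0 x : 1 <= x -> 0 <= arcosh x.
Proof.
by move=> x1; rewrite /arcosh ln_ge0 //; have := sqrtr_ge0 (x ^+ 2 - 1); lra.
Qed.

Lemma arcoshK x : 1 <= x -> cosh (arcosh x) = x.
Proof.
move=> x1; rewrite /arcosh.
set Q := Num.sqrt (x ^+ 2 - 1).
have Q2 : Q ^+ 2 = x ^+ 2 - 1 by rewrite sqr_sqrtr //; nra.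
have Q0 : 0 <= Q by exact: sqrtr_ge0.
have XQ : 0 < x + Q by nra.
rewrite /cosh expRN lnK ?posrE //.
have -> : (x + Q)^-1 = x - Q.
  apply: (mulfI (lt0r_neq0 XQ)); rewrite divff ?lt0r_neq0 //; nra.
by field.
Qed.

Lemma coshK x : 0 <= x -> arcosh (cosh x) = x.
Proof.
move=> x0; have c1 := cosh_ge1 x.
have := lexx (cosh x); rewrite -{1}(arcoshK c1) cosh_le.
have := lexx (cosh x); rewrite -{2}(arcoshK c1) cosh_le.
by rewrite !ger0_norm ?arcosh_ge0 // => ? ?; apply/le_anti/andP.
Qed.

Lemma arcosh_le x r : 0 <= r -> 1 <= x -> (arcosh x <= r) = (x <= cosh r).
Proof.
by move=> r0 x1; rewrite -{2}(arcoshK x1) cosh_le !ger0_norm ?arcosh_ge0.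
Qed.

Lemma tanh_gt0 r : 0 < r -> 0 < tanh r.
Proof.
move=> r0; rewrite /tanh divr_gt0 ?cosh_gt0 // /sinh divr_gt0 //.
by rewrite subr_gt0 ltr_expR; lra.
Qed.

(** Since [tanh r <= 2 * r] and [tanh r <= 1], [(1 + r) * tanh r <= 2 * r + r]. The first inequality
    comes from [1 - 2 * r <= expR (- (2 * r))]. *)
Lemma tanh_bound r : 0 < r -> 1 + r <= 3 * (r / tanh r).
Proof.
move=> r0; have t0 := tanh_gt0 r0.
have := expR_ge1Dx (- (2 * r)).
have -> : expR (- (2 * r)) = expR (- r) * expR (- r) by rewrite -expRD; congr expR; ring.
move=> e2.
have : tanh r <= 1 /\ tanh r <= 2 * r.
  rewrite /tanh !ler_pdivrMr ?cosh_gt0 // /cosh /sinh.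
  have := expRxMexpNx_1 r.
  have : 1 < expR r by rewrite -expR0 ltr_expR.
  move: (expR r) (expR (- r)) e2 => a b e2 a1 ab.
  have b0 : 0 < b by nra.
  split; first lra.
  have : (a - b) <= 2 * r * a; last by nra.
  have -> : b = a * (b * b) by rewrite mulrA ab mul1r.
  nra.
move=> [t1 t2]; rewrite mulrA ler_pdivlMr //; nra.
Qed.

Lemma sqr_sinh_half x : cosh x = 1 + 2 * sinh (x / 2) ^+ 2.
Proof.
have -> : cosh x = cosh (x / 2 - (- (x / 2))) by congr cosh; field.
rewrite coshB coshN sinhN; have := cosh_sqr (x / 2).
by move: (cosh _) (sinh _) => a b ?; lra.
Qed.

(** Crude linear bounds, here and in [sinh_upper], from [1 + x <= expR x] alone; they feed the
    numerical estimate of [offset_pierces]. *)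
Lemma sinh_bounds x : 0 <= x -> x <= 1 -> 3 / 4 * x <= sinh x.
Proof.
move=> x0 x1; rewrite /sinh.
have e1 := expR_ge1Dx x; have := expRxMexpNx_1 x; have := expR_gt0 (- x).
move: (expR x) (expR (- x)) e1 => a b e1 b0 ab.
have : b * (1 + x) <= 1 by nra.
have : b <= 1 - x / 2 by nra.
by lra.
Qed.

Lemma sinh_upper x : 0 <= x -> x <= 1 / 4 -> sinh x <= 5 / 4 * x.
Proof.
move=> x0 x1; rewrite /sinh.
have e1 := expR_ge1Dx (- x); have := expRxMexpNx_1 x; have := expR_gt0 x.
move: (expR x) (expR (- x)) e1 => a b e1 b0 ab.
have : a * (1 - x) <= 1 by nra.
have : a <= 1 + 4 / 3 * x by nra.
lra.
Qed.
End HyperbolicFunctions.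

(** * Disks in the hyperboloid model *)

Section HyperbolicPlane.
Context {R : realType}.
Implicit Types (p q c : h2 R) (r phi : R).

(** The negated Minkowski product. On the hyperboloid it is the cosh of the distance, so disks are
    its sublevel sets and [arcosh] disappears from the computations. *)
Definition form p q : R := h2t p * h2t q - h2x p * h2x q - h2y p * h2y q.

Lemma h2t_sqr p : h2t p ^+ 2 = 1 + h2x p ^+ 2 + h2y p ^+ 2.
Proof. by rewrite /h2t sqr_sqrtr //; nra. Qed.

Lemma h2t_ge1 p : 1 <= h2t p.
Proof.
have t0 : 0 <= h2t p by exact: sqrtr_ge0.
have := h2t_sqr p; nra.
Qed.

Lemma h2t_eq p (t : R) :
  0 <= t -> t ^+ 2 = 1 + h2x p ^+ 2 + h2y p ^+ 2 -> h2t p = t.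
Proof. by move=> t0 tE; rewrite /h2t -tE sqrtr_sqr ger0_norm. Qed.

Lemma le_of_sqr (a b : R) : 0 <= b -> a ^+ 2 <= b ^+ 2 -> a <= b.
Proof. by move=> b0 ab; nra. Qed.

Lemma cauchy_schwarz_h2t p q : 1 + h2x p * h2x q + h2y p * h2y q <= h2t p * h2t q.
Proof.
apply: le_of_sqr; first by rewrite mulr_ge0 ?sqrtr_ge0.
rewrite exprMn !h2t_sqr.
move: (h2x p) (h2y p) (h2x q) (h2y q) => a b x y.
have : 0 <= (a * y - x * b) ^+ 2 + (a - x) ^+ 2 + (b - y) ^+ 2.
  by rewrite !addr_ge0 ?sqr_ge0.
lra.
Qed.

Lemma form_ge1 p q : 1 <= form p q.
Proof. by have := cauchy_schwarz_h2t p q; rewrite /form; lra. Qed.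

Lemma diskE r c p : 0 <= r -> disk r c p <-> form p c <= cosh r.
Proof. by move=> r0; rewrite /disk /= /hdist arcosh_le ?form_ge1. Qed.

Lemma disk_center r c : 0 <= r -> disk r c c.
Proof.
move=> r0; apply/diskE => //; rewrite /form.
have := h2t_sqr c; have := cosh_ge1 r; lra.
Qed.

Lemma cosh_hdist_pole p : cosh (hdist (@pole R) p) = h2t p.
Proof.
have -> : hdist (@pole R) p = arcosh (h2t p).
  rewrite /hdist /= (_ : h2t (pole R) = 1) ?mul0r ?mul1r ?subr0 //.
  by apply: h2t_eq => //=; ring.
by rewrite arcoshK ?h2t_ge1.
Qed.

Lemma hdist_pole_ge0 p : 0 <= hdist (@pole R) p.
Proof. by rewrite arcosh_ge0 ?form_ge1. Qed.

(** The triangle inequality through the pole. After taking cosh, it becomes the planar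
    Cauchy-Schwarz inequality, because the sinh of the distance to the pole is the Euclidean norm of
    (x, y). *)
Lemma disk_radial r c p : 0 <= r -> disk r c p ->
  `|hdist (@pole R) p - hdist (@pole R) c| <= r.
Proof.
move=> r0 /diskE-/(_ r0) pc; rewrite -[leRHS]ger0_norm // -cosh_le.
apply: le_trans pc; rewrite coshB !cosh_hdist_pole /form.
have := cosh_sqr (hdist (@pole R) p); have := cosh_sqr (hdist (@pole R) c).
rewrite !cosh_hdist_pole !h2t_sqr.
have := @sinh_ge0 R _ (hdist_pole_ge0 p); have := @sinh_ge0 R _ (hdist_pole_ge0 c).
move: (sinh (hdist (@pole R) p)) (sinh (hdist (@pole R) c)).
move=> a b b0 a0 bE aE.
suff : h2x p * h2x c + h2y p * h2y c <= a * b by lra.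
apply: le_of_sqr; first exact: mulr_ge0.
have -> : (a * b) ^+ 2 = (h2x p ^+ 2 + h2y p ^+ 2) * (h2x c ^+ 2 + h2y c ^+ 2).
  by rewrite exprMn; congr (_ * _); lra.
have : 0 <= (h2x p * h2y c - h2x c * h2y p) ^+ 2 by rewrite sqr_ge0.
lra.
Qed.

Lemma theta_polar p : exists2 rho, 0 <= rho &
  [/\ h2x p = rho * cos (theta p), h2y p = rho * sin (theta p) &
      0 <= theta p <= 2 * pi].
Proof.
have p0 := pi_ge0 R.
rewrite /theta; case: ifP => [/andP[/eqP-> /eqP->]|/negbT xy].
  by exists 0 => //; split; rewrite ?mul0r //; lra.
set rho := Num.sqrt _.
have S : 0 <= h2x p ^+ 2 + h2y p ^+ 2 by rewrite addr_ge0 ?sqr_ge0.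
have rho2 : rho ^+ 2 = h2x p ^+ 2 + h2y p ^+ 2 by rewrite sqr_sqrtr.
have rho0 : 0 < rho.
  rewrite sqrtr_gt0 lt_neqAle S andbT eq_sym.
  by rewrite paddr_eq0 ?sqr_ge0 // !sqrf_eq0.
set z := h2x p / rho.
have zE : h2x p = rho * z by rewrite /z mulrC divfK ?lt0r_neq0.
have w2 : rho ^+ 2 * (1 - z ^+ 2) = h2y p ^+ 2.
  by move: rho2; rewrite zE exprMn; lra.
have z1 : 0 <= 1 - z ^+ 2.
  by rewrite -(pmulr_rge0 _ (exprn_gt0 2 rho0)) w2 sqr_ge0.
have zI : -1 <= z <= 1 by apply/andP; split; nra.
have sE : rho * Num.sqrt (1 - z ^+ 2) = `|h2y p|.
  by rewrite -sqrtr_sqr -w2 sqrtrM ?sqr_ge0 // sqrtr_sqr ger0_norm // ltW.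
have [/andP[a0 a1] cE] := acos_def zI.
exists rho; first exact: ltW.
have [y0|y0] := leP 0 (h2y p).
  split; last lra.
  - by rewrite cE.
  - by rewrite sin_acos // sE ger0_norm.
have -> : 2 * pi - acos z = - acos z + pi *+ 2 by ring.
rewrite cosD2pi sinD2pi cosN sinN cE sin_acos // mulrN sE ltr0_norm // opprK.
by split=> //; rewrite -mulr_natl; lra.
Qed.

Definition ray phi (s : R) : h2 R := H2 (s * cos phi) (s * sin phi).

Definition hits r c phi := exists2 s, 0 <= s & disk r c (ray phi s).

(** Straight in the (x, y) chart, hence not a geodesic in general. This is enough, as rays from the
    pole are half-lines of the same chart. *)
Definition segment p q (l : R) : h2 R :=
  H2 ((1 - l) * h2x p + l * h2x q) ((1 - l) * h2y p + l * h2y q).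

(* In the coordinates (x, y), h2t is a Euclidean norm in dimension 3 restricted
   to an affine plane, so every disk is a convex subset of the plane. *)
Lemma disk_convex r c p q (l : R) : 0 <= r -> 0 <= l <= 1 ->
  disk r c p -> disk r c q -> disk r c (segment p q l).
Proof.
move=> r0 /andP[l0 l1] /diskE-/(_ r0) pc /diskE-/(_ r0) qc; apply/diskE => //.
have tle : h2t (segment p q l) <= (1 - l) * h2t p + l * h2t q.
  have ? := h2t_ge1 p; have ? := h2t_ge1 q.
  apply: le_of_sqr; first by nra.
  have -> : ((1 - l) * h2t p + l * h2t q) ^+ 2 = (1 - l) ^+ 2 * h2t p ^+ 2
      + l ^+ 2 * h2t q ^+ 2 + 2 * ((1 - l) * l) * (h2t p * h2t q) by ring.
  rewrite !h2t_sqr /=.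
  have ll : 0 <= (1 - l) * l by nra.
  have := ler_wpM2l ll (cauchy_schwarz_h2t p q); lra.
have t0 : 0 <= h2t c by exact: sqrtr_ge0.
have := ler_wpM2r t0 tle; rewrite /form /= in pc qc *.
have l1' : 0 <= 1 - l by lra.
have := ler_wpM2l l1' pc; have := ler_wpM2l l0 qc; lra.
Qed.

Lemma sin_ge0_pi2pi (x : R) : pi <= x <= 2 * pi -> sin x <= 0.
Proof.
move=> /andP[a b]; have -> : x = (x - pi) + pi by ring.
by rewrite sinDpi oppr_le0 sin_ge0_pi //; apply/andP; split; lra.
Qed.

Lemma sin_eq0_0pi (x : R) : 0 <= x -> x <= pi -> sin x = 0 -> x = 0 \/ x = pi.
Proof.
move=> x0 x1 sx; have [->|x0'] := eqVneq x 0; first by left.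
have [->|x1'] := eqVneq x pi; first by right.
have := @sin_gt0_pi R x; rewrite sx ltxx => /(_ _)/wrap[] //.
by rewrite !lt_neqAle x0 x1 eq_sym x0' x1'.
Qed.

Lemma segment_polar p q (P Q f u v : R) :
  h2x p = P * cos (f - u) -> h2y p = P * sin (f - u) ->
  h2x q = Q * cos (f + v) -> h2y q = Q * sin (f + v) ->
  0 <= P -> 0 <= Q -> 0 <= sin u -> 0 <= sin v -> 0 <= sin (u + v) ->
  0 < P * sin u + Q * sin v ->
  exists2 l, 0 <= l <= 1 & exists2 s, 0 <= s & segment p q l = ray f s.
Proof.
move=> px py qx qy P0 Q0 u0 v0 uv0 AB.
have A0 : 0 <= P * sin u by exact: mulr_ge0.
have B0 : 0 <= Q * sin v by exact: mulr_ge0.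
(* [P * sin u] and [Q * sin v] are the distances of p and q to the line of angle f, on opposite
   sides of it. *)
exists (P * sin u / (P * sin u + Q * sin v)).
  by rewrite divr_ge0 ?addr_ge0 //= ler_pdivrMr // mul1r; lra.
(* The ray cuts the triangle formed by the pole, p and q into two triangles; s comes from adding
   their areas. *)
exists (P * Q * sin (u + v) / (P * sin u + Q * sin v)).
  by rewrite divr_ge0 ?addr_ge0 // mulr_ge0 // mulr_ge0.
rewrite /segment /ray px py qx qy cosB sinB cosD sinD sinD.
have := lt0r_neq0 AB.
move: (sin u) (cos u) (sin v) (cos v) (sin f) (cos f) => su cu sv cv sf cf AB0.
by congr H2; field.
Qed.

(* A segment between points of angles a <= b crosses the ray of angle phi
   in [a, b] if it turns by at most pi, and otherwise the ray of angle 0. *)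
Lemma segment_crosses_ray p q phi : theta p <= phi -> phi <= theta q ->
  exists2 l, 0 <= l <= 1 &
    (exists2 s, 0 <= s & segment p q l = ray phi s) \/
    (exists2 s, 0 <= s & segment p q l = ray 0 s).
Proof.
have [P P0 [px py /andP[a0 a1]]] := theta_polar p.
have [Q Q0 [qx qy /andP[b0 b1]]] := theta_polar q.
move: (theta p) (theta q) a0 a1 b0 b1 px py qx qy => a b a0 a1 b0 b1 px py qx qy ap pb.
have p0 : 0 < pi :> R := pi_gt0 R.
have atp f s : 0 <= s -> h2x p = s * cos f -> h2y p = s * sin f ->
    exists2 l, 0 <= l <= 1 & exists2 s, 0 <= s & segment p q l = ray f s.
  move=> s0 xE yE; exists 0; first lra.
  by exists s => //; rewrite /segment /ray; congr H2; lra.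
have atq f s : 0 <= s -> h2x q = s * cos f -> h2y q = s * sin f ->
    exists2 l, 0 <= l <= 1 & exists2 s, 0 <= s & segment p q l = ray f s.
  move=> s0 xE yE; exists 1; first lra.
  by exists s => //; rewrite /segment /ray; congr H2; lra.
have useL : (exists2 l, 0 <= l <= 1 &
    exists2 s, 0 <= s & segment p q l = ray phi s) ->
    exists2 l, 0 <= l <= 1 &
      (exists2 s, 0 <= s & segment p q l = ray phi s) \/
      (exists2 s, 0 <= s & segment p q l = ray 0 s).
  by move=> [l l01 H]; exists l => //; left.
have useR : (exists2 l, 0 <= l <= 1 &
    exists2 s, 0 <= s & segment p q l = ray 0 s) ->
    exists2 l, 0 <= l <= 1 &
      (exists2 s, 0 <= s & segment p q l = ray phi s) \/
      (exists2 s, 0 <= s & segment p q l = ray 0 s).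
  by move=> [l l01 H]; exists l => //; right.
have [Pz|Pn] := eqVneq P 0.
  by apply/useL/(atp _ 0); rewrite // ?px ?py Pz !mul0r.
have [Qz|Qn] := eqVneq Q 0.
  by apply/useL/(atq _ 0); rewrite // ?qx ?qy Qz !mul0r.
have Pp : 0 < P by rewrite lt_neqAle eq_sym Pn.
have Qp : 0 < Q by rewrite lt_neqAle eq_sym Qn.
(* Isolates the degenerate position, pole, p and q collinear with the ray, in which the denominator
   of [segment_polar] vanishes. *)
have pos (x y : R) : 0 <= sin x -> 0 <= sin y ->
    (sin x = 0 /\ sin y = 0) \/ (0 < P * sin x + Q * sin y /\ 0 < P * sin y + Q * sin x).
  move=> x0 y0; have [xz|xn] := eqVneq (sin x) 0; last first.
    right; have xp : 0 < sin x by rewrite lt_neqAle eq_sym xn.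
    by split; nra.
  have [yz|yn] := eqVneq (sin y) 0; first by left.
  right; have yp : 0 < sin y by rewrite lt_neqAle eq_sym yn.
  by split; nra.
have [ba|ba] := leP (b - a) pi.
  have su : 0 <= sin (phi - a) by apply: sin_ge0_pi; lra.
  have sv : 0 <= sin (b - phi) by apply: sin_ge0_pi; lra.
  have [[uz _]|[AB _]] := pos _ _ su sv; last first.
    apply/useL/(@segment_polar p q P Q phi (phi - a) (b - phi)) => //.
    - by rewrite px; congr (_ * cos _); ring.
    - by rewrite py; congr (_ * sin _); ring.
    - by rewrite qx; congr (_ * cos _); ring.
    - by rewrite qy; congr (_ * sin _); ring.
    - by apply: sin_ge0_pi; lra.
  (* Either phi = a, or phi = a + pi, which forces phi = b because b - a is at most pi. *)
  have [||ua|ua] := @sin_eq0_0pi (phi - a) _ _ uz; [lra|lra| |].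
    have -> : phi = a by lra.
    by move: (atp a P P0 px py) => [l l01 H]; exists l => //; left.
  have -> : phi = b by lra.
  by move: (atq b Q Q0 qx qy) => [l l01 H]; exists l => //; left.
(* Now a < pi < b and the segment turns the other way, through the polar axis: [segment_polar] is
   applied from q to p with f = 0, u = 2 pi - b, v = a. *)
have sa : 0 <= sin a by apply: sin_ge0_pi; lra.
have sbE : sin (2 * pi - b) = - sin b.
  have -> : 2 * pi - b = - b + pi *+ 2 by ring.
  by rewrite sinD2pi sinN.
have cbE : cos (2 * pi - b) = cos b.
  have -> : 2 * pi - b = - b + pi *+ 2 by ring.
  by rewrite cosD2pi cosN.
have sb : 0 <= sin (2 * pi - b).
  by rewrite sbE oppr_ge0; apply: sin_ge0_pi2pi; lra.
have [[_ az]|[_ AB]] := pos _ _ sb sa.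
  have [||a0'|a0'] := @sin_eq0_0pi a _ _ az; [lra|lra| |lra].
  by move: px py; rewrite a0' => px py; apply/useR/(atp 0 P).
have [||||||||||l l01 [s s0 E]] := @segment_polar q p Q P 0 (2 * pi - b) a.
- by rewrite sub0r cosN cbE.
- by rewrite sub0r sinN sbE opprK.
- by rewrite add0r.
- by rewrite add0r.
- by [].
- by [].
- by [].
- by [].
- by apply: sin_ge0_pi; lra.
- lra.
apply: useR; exists (1 - l); first lra.
exists s => //; rewrite -E /segment; congr H2; ring.
Qed.

Lemma hits_of_angles r c p q phi : 0 <= r -> disk r c p -> disk r c q ->
  theta p <= phi -> phi <= theta q -> hits r c phi \/ hits r c 0.
Proof.
move=> r0 pc qc pphi phiq.
have [l l01 H] := segment_crosses_ray pphi phiq.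
have := disk_convex r0 l01 pc qc.
by case: H => -[s s0 ->] d; [left|right]; exists s.
Qed.
End HyperbolicPlane.

(** * Piercing the disks that meet a ray *)

Section Piercing.
Context {R : realType}.
Implicit Types (c : h2 R) (r phi a f w h : R).

(* The point with Fermi coordinates (a, h) about the ray of angle phi. *)
Definition fermi phi a h : h2 R :=
  H2 (cos phi * (sinh a * cosh h) - sin phi * sinh h)
     (sin phi * (sinh a * cosh h) + cos phi * sinh h).

Lemma h2t_fermi phi a h : h2t (fermi phi a h) = cosh a * cosh h.
Proof.
apply: h2t_eq => /=; first by rewrite mulr_ge0 // ltW ?cosh_gt0.
rewrite exprMn cosh_sqr; have := cosh_sqr h; have := cos2Dsin2 phi.
move: (cosh h) (sinh h) (sinh a) (cos phi) (sin phi) => C S u x y xy CS.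
have -> : 1 + (x * (u * C) - y * S) ^+ 2 + (y * (u * C) + x * S) ^+ 2 =
  1 + (x ^+ 2 + y ^+ 2) * (u ^+ 2 * C ^+ 2 + S ^+ 2) by ring.
by rewrite xy CS; ring.
Qed.

Lemma form_fermi phi a h f w : form (fermi phi a h) (fermi phi f w) =
  cosh h * cosh w * cosh (a - f) - sinh h * sinh w.
Proof.
rewrite /form !h2t_fermi coshB /=; have := cos2Dsin2 phi.
move: (cos phi) (sin phi) (cosh a) (sinh a) (cosh f) (sinh f) (cosh h) (sinh h)
  (cosh w) (sinh w) => x y ca sa cf sf ch sh cw sw xy.
set L := LHS; have -> : L = ca * ch * (cf * cw)
    - (x ^+ 2 + y ^+ 2) * (sa * ch * (sf * cw) + sh * sw) by rewrite /L; ring.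
by rewrite xy; ring.
Qed.

Lemma fermi_surj phi c : exists f w, c = fermi phi f w.
Proof.
have [w wE] := sinh_surj (cos phi * h2y c - sin phi * h2x c).
have [f fE] := sinh_surj ((cos phi * h2x c + sin phi * h2y c) / cosh w).
exists f, w; rewrite /fermi fE wE divfK ?lt0r_neq0 ?cosh_gt0 //.
case: c {wE fE} => u v /=; have := cos2Dsin2 phi.
move: (cos phi) (sin phi) => x y xy.
have -> : x * (x * u + y * v) - y * (x * v - y * u) = (x ^+ 2 + y ^+ 2) * u by ring.
have -> : y * (x * u + y * v) + x * (x * v - y * u) = (x ^+ 2 + y ^+ 2) * v by ring.
by rewrite xy !mul1r.
Qed.

Lemma ray_fermi phi a : ray phi (sinh a) = fermi phi a 0.
Proof.
have c0 : cosh 0 = 1 :> R by rewrite /cosh oppr0 expR0; field.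
have s0 : sinh 0 = 0 :> R by rewrite /sinh oppr0 subrr mul0r.
by rewrite /ray /fermi c0 s0; congr H2; ring.
Qed.

(** Proportional to r for small r, so that a length 4r spans a bounded number of cells; capped at 1,
    where the linear estimates of sinh still apply. *)
Definition mesh r : R := Num.min r 1 / 8.
Definition offset r : R := Num.min r 1 / 4.

Lemma mesh_gt0 r : 0 < r -> 0 < mesh r.
Proof. by move=> r0; rewrite /mesh divr_gt0 // lt_min r0 /=. Qed.

(** Here w is the signed distance of a center to a geodesic and e the distance along it from a grid
    point to the foot of the center. As the disk misses the grid point, the center is not close to
    the geodesic; moving the grid point by [offset r] towards the center then gains more than the
    displacement e costs. *)
Lemma offset_pierces r w e : 0 < r -> `|e| <= mesh r -> cosh w <= cosh r ->
  cosh r < cosh w * cosh e ->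
  cosh (offset r) * cosh w * cosh e <= cosh r + sinh (offset r) * `|sinh w|.
Proof.
move=> r0 em wr rw; rewrite /offset; move: em; rewrite /mesh.
set x := Num.min r 1.
have x0 : 0 < x by rewrite /x lt_min r0 /=.
have x1 : x <= 1 by rewrite /x ge_min lexx orbT.
have xr : x <= r by rewrite /x ge_min lexx.
have cx : 1 + 9 / 32 * x ^+ 2 <= cosh r.
  apply: (@le_trans _ _ (cosh x)); last first.
    by rewrite cosh_le !ger0_norm // ltW.
  have : 3 / 4 * (x / 2) <= sinh (x / 2) by apply: sinh_bounds; lra.
  rewrite sqr_sinh_half; nra.
have ch : 1 <= cosh (x / 4) <= 1 + x ^+ 2 / 20.
  rewrite cosh_ge1 /=.
  have : sinh (x / 4 / 2) <= 5 / 4 * (x / 4 / 2) by apply: sinh_upper; lra.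
  have : 0 <= sinh (x / 4 / 2) by apply: sinh_ge0; lra.
  rewrite sqr_sinh_half; nra.
have sh : 3 / 16 * x <= sinh (x / 4).
  have : 3 / 4 * (x / 4) <= sinh (x / 4) by apply: sinh_bounds; lra.
  lra.
move=> em; have ce : 1 <= cosh e <= 1 + x ^+ 2 / 80.
  rewrite cosh_ge1 /=; apply: (@le_trans _ _ (cosh (x / 8))).
    by rewrite cosh_le; apply: le_trans em _; rewrite ger0_norm //; lra.
  have : sinh (x / 8 / 2) <= 5 / 4 * (x / 8 / 2) by apply: sinh_upper; lra.
  have : 0 <= sinh (x / 8 / 2) by apply: sinh_ge0; lra.
  rewrite sqr_sinh_half; nra.
have := cosh_sqr w; have := cosh_ge1 w; have := normr_ge0 (sinh w).
have : sinh w ^+ 2 = `|sinh w| ^+ 2 by rewrite real_normK ?num_real.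
move: (cosh w) (sinh w) `|sinh w| (cosh r) (cosh e) (cosh (x / 4)) (sinh (x / 4))
  wr rw cx ch sh ce => W Y0 Y C E D S WC CWE Cx /andP[D1 Dx] Sx /andP[E1 Ex] -> Y00 W1 WY.
have x2 : 0 <= x ^+ 2 <= 1 by nra.
have W14 : 1 + x ^+ 2 / 4 <= W by nra.
have YW : 2 / 5 * x * W <= Y.
  apply: le_of_sqr => //.
  have : W ^+ 2 * (1 - 4 / 25 * x ^+ 2) >= 1; nra.
have DE : D * E <= 1 + 3 / 40 * x ^+ 2 by nra.
(* The loss is at most 3/40 x^2 W; the gain S Y is at least (3/16 x)(2/5 x W), the same quantity. *)
have : D * E * W <= W + 3 / 40 * x ^+ 2 * W by nra.
have : 3 / 40 * x ^+ 2 * W <= S * Y; nra.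
Qed.

(** In Fermi coordinates the disk meets the ray in an interval centered at the foot f of its center.
    If it contains a but neither end of the cell, f lies in the cell and [offset_pierces] applies on
    the side of the center. *)
Lemma pierced r c phi a s : 0 < r -> disk r c (ray phi (sinh a)) ->
  s <= a -> a <= s + mesh r ->
  [\/ disk r c (fermi phi s 0), disk r c (fermi phi (s + mesh r) 0),
      disk r c (fermi phi s (offset r)) | disk r c (fermi phi s (- offset r))].
Proof.
move=> r0 + sa as_; have r0' := ltW r0; rewrite ray_fermi.
have [f [w ->]] := fermi_surj phi c.
have D b h : disk r (fermi phi f w) (fermi phi b h) <->
    cosh h * cosh w * cosh (b - f) - sinh h * sinh w <= cosh r.
  by rewrite -(form_fermi phi); exact: diskE.
have c0 : cosh 0 = 1 :> R by rewrite /cosh oppr0 expR0; field.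
have s0 : sinh 0 = 0 :> R by rewrite /sinh oppr0 subrr mul0r.
have D0 b : disk r (fermi phi f w) (fermi phi b 0) <->
    cosh w * cosh (b - f) <= cosh r.
  by rewrite D c0 s0 mul1r mul0r subr0.
have W0 := cosh_gt0 w.
move=> /D0 Ha.
have [/D0 ?|N1] := leP (cosh w * cosh (s - f)) (cosh r); first by constructor 1.
have [/D0 ?|N2] := leP (cosh w * cosh (s + mesh r - f)) (cosh r).
  by constructor 2.
have := le_lt_trans Ha N1; have := le_lt_trans Ha N2.
rewrite !ltr_pM2l // !cosh_lt => n2 n1.
(* Being nearer to a than to s and than to s + mesh, f lies between these two. *)
have e1 : `|s - f| <= mesh r.
  by move: n1 n2; do 3 (case: ger0P => ?); move=> *; lra.
have wr : cosh w <= cosh r.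
  by apply: le_trans Ha; rewrite ler_peMr ?cosh_ge1 // ltW.
have := offset_pierces r0 e1 wr N1.
have [w0|w0] := leP 0 (sinh w).
  rewrite ger0_norm // => H; constructor 3; apply/D; lra.
rewrite ltr0_norm // => H; constructor 4; apply/D.
rewrite coshN sinhN; lra.
Qed.

Definition pin r phi (j : nat) (k : 'I_4) : h2 R :=
  match val k with
  | 0 => fermi phi (j%:R * mesh r) 0
  | 1 => fermi phi (j%:R * mesh r + mesh r) 0
  | 2 => fermi phi (j%:R * mesh r) (offset r)
  | _ => fermi phi (j%:R * mesh r) (- offset r)
  end.

(** The bound on j confines the grid indices of one layer to a window of length O(1 + r), which is
    what makes the count finite. *)
Lemma hits_pin r c phi : 0 < r -> hits r c phi -> exists j k,
  disk r c (pin r phi j k) /\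
  `|j%:R * mesh r - hdist (@pole R) c| <= r + mesh r.
Proof.
move=> r0 [_ /sinh_surj_ge0[a a0 <-] da]; have m0 := mesh_gt0 r0.
have q0 : 0 <= a / mesh r by rewrite divr_ge0 // ltW.
have /andP[ja aj] := Num.Theory.truncn_itv q0.
set j := Num.truncn _ in ja aj.
move: ja; rewrite ler_pdivlMr // => ja.
move: aj; rewrite ltr_pdivrMr // => aj.
have ja' : a <= j%:R * mesh r + mesh r by move: aj; rewrite -natr1 mulrDl mul1r => /ltW.
have hj : `|j%:R * mesh r - hdist (@pole R) c| <= r + mesh r.
  have := disk_radial (ltW r0) da.
  have -> : hdist (@pole R) (ray phi (sinh a)) = a.
    rewrite -[RHS](@coshK R) //.
    have <- : h2t (ray phi (sinh a)) = cosh a.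
      by rewrite ray_fermi h2t_fermi /(cosh 0) oppr0 expR0; field.
    by rewrite -cosh_hdist_pole coshK // hdist_pole_ge0.
  by do 2 (case: ger0P => ?); move=> *; lra.
have [d|d|d|d] := pierced r0 da ja ja'.
- by exists j, (inord 0); rewrite /pin /= inordK.
- by exists j, (inord 1); rewrite /pin /= inordK.
- by exists j, (inord 2); rewrite /pin /= inordK.
- by exists j, (inord 3); rewrite /pin /= inordK.
Qed.
End Piercing.

(** * Angular intervals and packing *)

Section AngularIntervals.
Context {R : realType}.
Implicit Types (c p : h2 R) (r phi : R).

Definition inf_angle r c : R := inf (image (disk r c) (@theta R)).
Definition sup_angle r c : R := sup (image (disk r c) (@theta R)).

Lemma has_sup_angle r c : 0 <= r -> has_sup (image (disk r c) (@theta R)).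
Proof.
move=> r0; split; first by exists (theta c), c => //; exact: disk_center.
by exists (2 * pi) => _ [p _ <-]; have [? _ [_ _ /andP[]]] := theta_polar p.
Qed.

Lemma has_inf_angle r c : 0 <= r -> has_inf (image (disk r c) (@theta R)).
Proof.
move=> r0; split; first by exists (theta c), c => //; exact: disk_center.
by exists 0 => _ [p _ <-]; have [? _ [_ _ /andP[]]] := theta_polar p.
Qed.

Lemma inf_angle_le r c p : 0 <= r -> disk r c p -> inf_angle r c <= theta p.
Proof.
move=> r0 cp; apply: ge_inf; first by case: (has_inf_angle c r0).
by exists p.
Qed.

Lemma sup_angle_ge r c p : 0 <= r -> disk r c p -> theta p <= sup_angle r c.
Proof.
move=> r0 cp; apply: ub_le_sup; first by case: (has_sup_angle c r0).
by exists p.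
Qed.

(* As the extremal angles of a disk need not be attained, disks whose interval
   has phi as an endpoint are caught by two further rays close to phi. *)
Lemma rays_of_angle r phi (V : finType) (c : V -> h2 R) : 0 < r ->
  exists f : 'I_4 -> R, forall v,
    inf_angle r (c v) <= phi -> phi <= sup_angle r (c v) ->
    exists k, hits r (c v) (f k).
Proof.
move=> r0; have r0' := ltW r0.
(* If the center of v is before phi and its supremum is at least phi, then its center is at or
   before [lo] and some point of its disk is beyond [lo], so [lo] separates two points of the disk;
   [hi] is symmetric. The defaults only keep [lo < phi < hi] when no such center exists. *)
pose lo := \big[Num.max/phi - 1]_(v | theta (c v) < phi) theta (c v).
pose hi := \big[Num.min/phi + 1]_(v | phi < theta (c v)) theta (c v).
have lo_lt : lo < phi by apply: bigmax_lt => //; lra.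
have hi_gt : phi < hi by apply: lt_bigmin => //; lra.
exists (fun k : 'I_4 => nth 0 [:: 0; phi; lo; hi] k) => v vi vs.
have hit0 : hits r (c v) 0 -> exists k : 'I_4,
    hits r (c v) (nth 0 [:: 0; phi; lo; hi] k).
  by exists (inord 0); rewrite inordK.
have dc := disk_center (c v) r0'.
have hitS k p q psi : disk r (c v) p -> disk r (c v) q -> (k < 4)%N ->
    nth 0 [:: 0; phi; lo; hi] k = psi -> theta p <= psi -> psi <= theta q ->
    exists k : 'I_4, hits r (c v) (nth 0 [:: 0; phi; lo; hi] k).
  move=> dp dq k4 kE pp qq; have [h|] := hits_of_angles r0' dp dq pp qq.
    by exists (inord k); rewrite inordK // kE.
  exact: hit0.
case: (ltrgtP (theta (c v)) phi) => [cphi|phic|cE]; last first.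
- by apply: (hitS 1%N (c v) (c v) phi) => //; rewrite cE.
- have [|p [y yp <-] plt] := @inf_adherent _ _ (hi - phi) _ (has_inf_angle (c v) r0').
    by lra.
  have [ple|plt'] := leP (theta y) phi.
    by apply: (hitS 1%N y (c v) phi) => //; exact: ltW.
  apply: (hitS 3%N y (c v) hi) => //; last exact: bigmin_le_cond.
  by move: vi; rewrite /inf_angle; lra.
have [|p [y yp <-] plt] := @sup_adherent _ _ (phi - lo) _ (has_sup_angle (c v) r0').
  by lra.
have [ple|plt'] := leP phi (theta y).
  by apply: (hitS 1%N (c v) y phi) => //; exact: ltW.
apply: (hitS 2%N (c v) y lo) => //; first exact: le_bigmax_cond.
by move: vs; rewrite /sup_angle; lra.
Qed.

Section UniformDiskGraph.
Variables (r : R) (V : finType) (G : rel V) (c : V -> h2 R).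
Hypotheses (r0 : 0 < r) (Gc : realizes r G c).

Lemma realizes_radial u v : G u v ->
  hdist (@pole R) (c v) <= hdist (@pole R) (c u) + 2 * r.
Proof.
move=> /Gc[_ [p [up vp]]].
have := disk_radial (ltW r0) up; have := disk_radial (ltW r0) vp.
by do 2 (case: ger0P => ?); move=> *; lra.
Qed.

Lemma realizes_angles u v : G u v -> inf_angle r (c u) <= sup_angle r (c v).
Proof.
move=> /Gc[_ [p [up vp]]]; apply: le_trans (inf_angle_le (ltW r0) up) _.
exact: sup_angle_ge (ltW r0) vp.
Qed.

Lemma inf_le_sup_angle v : inf_angle r (c v) <= sup_angle r (c v).
Proof.
have d := disk_center (c v) (ltW r0).
exact: le_trans (inf_angle_le (ltW r0) d) (sup_angle_ge (ltW r0) d).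
Qed.

Lemma realizes_sym : symmetric G.
Proof.
have H u v : G u v -> G v u.
  by move=> /Gc[uv [p [up vp]]]; apply/Gc; split; [exact: nesym|exists p].
by move=> u v; apply/idP/idP; exact: H.
Qed.

Lemma stable_disk_eq (S : {set V}) u v p : stable G S -> u \in S -> v \in S ->
  disk r (c u) p -> disk r (c v) p -> u = v.
Proof.
move=> /forall_inP St uS vS up vp; apply/eqP/negPn/negP => /eqP uv.
have /forall_inP/(_ v vS)/negP := St u uS.
by apply; apply/Gc; split=> //; exists p.
Qed.

(* The vertices of S are determined by their layer, a ray hit by their disk,
   a point of that ray's grid inside the disk (modulo a number J exceeding the
   range of grid points relevant to the layer), and the type of that point. *)
Lemma layered_packing phi (S : {set V}) m (layer : V -> 'I_m) J :
  stable G S -> 4 * r + 2 * mesh r <= J%:R * mesh r ->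
  {in S, forall v, inf_angle r (c v) <= phi <= sup_angle r (c v)} ->
  {in S &, forall u v, layer u = layer v ->
     hdist (@pole R) (c u) < hdist (@pole R) (c v) + 2 * r} ->
  (#|S| <= m * (4 * (J * 4)))%N.
Proof.
move=> St rJ Sphi Sd; have m0 := mesh_gt0 r0.
have J0 : (0 < J)%N.
  rewrite lt0n; apply/eqP => J0.
  move: rJ m0; move: (mesh r) => d; rewrite J0 mul0r leNgt => rd d0.
  by move: rd; rewrite addr_gt0 ?mulr_gt0.
have [f fP] := rays_of_angle phi c r0.
have E v : exists x : 'I_4 * nat * 'I_4, v \in S ->
    disk r (c v) (pin r (f x.1.1) x.1.2 x.2) /\
    `|x.1.2%:R * mesh r - hdist (@pole R) (c v)| <= r + mesh r.
  have [vS|_] := boolP (v \in S); last by exists (ord0, 0%N, ord0).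
  have /andP[vi vs] := Sphi v vS.
  have [k /(hits_pin r0)[j [l H]]] := fP v vi vs.
  by exists (k, j, l).
have [g gP] := choice E.
pose F v := (layer v, ((g v).1.1, (inord ((g v).1.2 %% J) : 'I_J.-1.+1, (g v).2))).
have -> : (m * (4 * (J * 4)) = #|{: 'I_m * ('I_4 * ('I_J.-1.+1 * 'I_4))}|)%N.
  by rewrite !card_prod !card_ord prednK.
apply: (@leq_card_in _ _ F) => u v uS vS [luv fuv juv kuv].
have [du nu] := gP u uS; have [dv nv] := gP v vS.
have jE : (g u).1.2 = (g v).1.2 %[mod J].
  by move: juv => /(congr1 val); rewrite /= !inordK ?prednK ?ltn_pmod.
suff jE' : (g u).1.2 = (g v).1.2.
  by apply: (stable_disk_eq St uS vS du); rewrite fuv jE' kuv.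
have d1 := Sd u v uS vS luv; have d2 := Sd v u vS uS (esym luv).
(* r + mesh for each pin, plus 2r for the width of a layer. Congruent indices at distance below J
   are equal, so no lowest index per layer has to be chosen. *)
have close : `|(g u).1.2%:R * mesh r - (g v).1.2%:R * mesh r| < J%:R * mesh r.
  by move: nu nv; do 3 (case: ger0P => ?); move=> *; lra.
move: (g u).1.2 (g v).1.2 jE close => {nu nv du dv fuv kuv juv} a b ab.
wlog ba : a b ab / (b <= a)%N.
  move=> W; case: (leqP b a) => [|/ltnW]; first exact: W.
  by move=> ab' H; apply/esym/W => //; rewrite distrC.
rewrite -mulrBl -natrB // normrM (gtr0_norm m0) ltr_pM2r // ger0_norm // ltr_nat.
move=> lt; apply/eqP; rewrite eqn_leq ba andbT -subn_eq0.
have : (J %| a - b)%N by rewrite -eqn_mod_dvd //; apply/eqP.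
case: (posnP (a - b)%N) => [-> //|d0 /(dvdn_leq d0)].
by rewrite leqNgt lt.
Qed.
End UniformDiskGraph.
End AngularIntervals.

(** * Path decompositions from layers and angles *)

Section PathDecomposition.

Definition adjacent_nat (i j : nat) : bool := (i.+1 == j) || (j.+1 == i).

Section Path.
Variables (m : nat) (E : rel 'I_m).
Hypothesis EE : forall i j, E i j = adjacent_nat i j.

Lemma path_connected_in (A : {set 'I_m}) :
  (forall i j k : 'I_m, (i <= j <= k)%N -> i \in A -> k \in A -> j \in A) ->
  connected_in E A.
Proof.
move=> convA; pose e := [rel x y | [&& E x y, x \in A & y \in A]].
have esym : connect_sym e.
  apply: sym_connect_sym => x y; rewrite /= !EE /adjacent_nat orbC.
  by rewrite [(x \in A) && _]andbC.
suff H d (s t : 'I_m) : (t = s + d :> nat)%N -> s \in A -> t \in A -> connect e s t.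
  move=> s t sA tA; case: (leqP s t) => [st|/ltnW ts].
    by apply: (H (t - s)%N) => //; rewrite subnKC.
  by rewrite esym; apply: (H (s - t)%N) => //; rewrite subnKC.
elim: d s t => [|d IH] s t ts sA tA.
  by rewrite (_ : s = t) ?connect0 //; apply/val_inj; rewrite /= ts addn0.
have um : (s + d < m)%N by rewrite (leq_trans _ (ltn_ord t)) // ts addnS.
pose u := Ordinal um.
have uA : u \in A by apply: (convA s u t) => //=; rewrite ts leq_addr leq_add2l leqnSn.
apply: connect_trans (IH s u erefl sA uA) (connect1 _).
by rewrite /= uA tA EE /adjacent_nat /= ts addnS eqxx.
Qed.

Lemma path_is_tree : (0 < m)%N -> is_tree E.
Proof.
move=> m0; split.
- by move=> x y; rewrite !EE /adjacent_nat orbC.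
- move=> x; rewrite EE /adjacent_nat orbb.
  by apply/negbTE; rewrite neq_ltn ltnSn orbT.
- by rewrite card_ord.
- by apply: path_connected_in => i j k _; rewrite !inE.
move=> s; case: s => [//|x0 s0] ss; apply/negP => /andP[].
set s := x0 :: s0 in ss *.
(* both neighbours of the largest vertex of a cycle would be its predecessor *)
have [x xs xmax] : exists2 x, x \in s & forall y, y \in s -> (y <= x)%N.
  have xs0 : x0 \in s by rewrite inE eqxx.
  case: (@arg_maxnP _ x0 (mem s) val xs0) => x xs xmax.
  by exists x.
have [i s' rotE] := rot_to xs.
rewrite -(rot_cycle i) -(rot_uniq i) rotE.
have : (forall y, y \in x :: s' -> (y <= x)%N).
  by move=> y; rewrite -rotE mem_rot; exact: xmax.
have : (2 < size (x :: s'))%N by rewrite -rotE size_rot.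
case: s' {rotE} => [//|y s'] /=; case/lastP: s' => [//|s' z] _ ub.
rewrite rcons_path last_rcons => /andP[xy /andP[_ zx]] /and3P[_ ynz _].
have yx : (y <= x)%N by apply: ub; rewrite !inE eqxx orbT.
have z_x : (z <= x)%N by apply: ub; rewrite !inE mem_rcons inE eqxx !orbT.
have yE : y.+1 = x :> nat.
  move: xy; rewrite EE => /orP[/eqP e|/eqP //].
  by move: yx; rewrite -e ltnn.
have zE : z.+1 = x :> nat.
  move: zx; rewrite EE => /orP[/eqP //|/eqP e].
  by move: z_x; rewrite -e ltnn.
have /val_inj yz : y = z :> nat by apply: succn_inj; rewrite yE zE.
by move: ynz; rewrite yz mem_rcons inE eqxx.
Qed.
End Path.

Section Rank.
Variables (n : nat) (lt : rel 'I_n).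
Hypotheses (ltI : irreflexive lt) (ltT : transitive lt).
Hypothesis ltC : forall u v, [|| lt u v, u == v | lt v u].

(** Position in the sorted order, obtained by counting: the machine computes it with a double loop
    and no sorting procedure. *)
Definition rank (u : 'I_n) : nat := #|[set w | lt w u]|.

Lemma rank_lt u v : lt u v -> (rank u < rank v)%N.
Proof.
move=> uv; apply/proper_card/properP; split.
  by apply/fintype.subsetP => w; rewrite !inE => wu; exact: ltT wu uv.
by exists u; rewrite !inE // ltI.
Qed.

Lemma rank_ltn u : (rank u < n)%N.
Proof.
rewrite -[ltnRHS]card_ord -cardsT; apply/proper_card/properP.
by split; [exact: finset.subsetT | exists u; rewrite ?inE // ltI].
Qed.

Lemma rankE u v : (rank u < rank v)%N = lt u v.
Proof.
apply/idP/idP; last exact: rank_lt.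
move=> uv; have /or3P[//|/eqP e|/rank_lt vu] := ltC u v.
  by move: uv; rewrite e ltnn.
by move: (ltn_trans uv vu); rewrite ltnn.
Qed.

Lemma rank_inj : injective rank.
Proof.
move=> u v uv; have /or3P[/rank_lt|/eqP //|/rank_lt] := ltC u v;
  by rewrite uv ltnn.
Qed.

Lemma rank_surj t : (t < n)%N -> exists u, rank u = t.
Proof.
move=> tn; pose f u := Ordinal (rank_ltn u).
have finj : injective f by move=> u v /(congr1 val)/rank_inj.
have [g _ gK] := injF_bij finj.
by exists (g (Ordinal tn)); have /(congr1 val) := gK (Ordinal tn).
Qed.
End Rank.
End PathDecomposition.

(** * Bags built from layers, blocks and starting angles *)

Section LayeredDecomposition.
Context {R : realType}.
Variables (r : R) (n : nat) (G : rel 'I_n) (c : 'I_n -> h2 R).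
Hypotheses (r0 : 0 < r) (Gc : realizes r G c).

(* Vertex v lies in layer [quo v * M + res v]; the layers of residue q are put
   into every bag, and [block] numbers the runs of layers between them. *)
Variables (M q : nat) (quo res : 'I_n -> nat).

Let dist v : R := hdist (@pole R) (c v).
Definition layer v : nat := (quo v * M + res v)%N.
Definition block v : nat := (quo v + (q < res v))%N.

(** The only facts about the computed layers, M and q on which the decomposition relies. M = 1
    covers n of order at most 1 + r, where all vertices may share every bag. *)
Record layering : Prop := Layering {
  res_lt : forall v, (res v < M)%N;
  layer_width : forall u v, layer u = layer v -> dist u < dist v + 2 * r;
  layer_gap : forall u v, (layer u + 2 <= layer v)%N -> dist u + 2 * r < dist v;
  deleted_small : (M * #|[set v | res v == q]| <= n)%N;
  modulus_small : M = 1%N \/ M%:R ^+ 2 * (1 + r) <= n%:R;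
  modulus_large : n%:R <= M.+1%:R ^+ 2 * (1 + r) :> R;
  residue_lt : (q < M)%N }.

Hypothesis L : layering.

Let lo v := inf_angle r (c v).
Let hi v := sup_angle r (c v).

(** Lexicographic by block, starting angle and index; the index makes the order total. *)
Definition before : rel 'I_n := fun u v =>
  (block u < block v)%N || ((block u == block v) &&
    ((lo u < lo v) || ((lo u == lo v) && (u < v)%N))).

(** The sweep is sampled at starting angles only: two intervals that meet share the larger of their
    left ends. *)
Definition in_bag (u w : 'I_n) : bool :=
  (res w == q) || [&& block w == block u, lo w <= lo u & lo u <= hi w].

Lemma before_irr : irreflexive before.
Proof. by move=> u; rewrite /before !ltnn !eqxx ltxx. Qed.

Lemma before_trans : transitive before.
Proof.
move=> v u w; rewrite /before.
move=> /orP[uv|/andP[/eqP-> uv]] /orP[vw|/andP[/eqP<- vw]].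
- by rewrite (ltn_trans uv vw).
- by rewrite uv.
- by rewrite vw.
rewrite eqxx ltnn /=.
case/orP: uv vw => [uv|/andP[/eqP-> uv]] /orP[vw|/andP[/eqP<- vw]].
- by rewrite (lt_trans uv vw).
- by rewrite uv.
- by rewrite vw.
by rewrite ltxx eqxx (ltn_trans uv vw).
Qed.

Lemma before_total u v : [|| before u v, u == v | before v u].
Proof.
rewrite /before; case: (ltngtP (block u) (block v)) => _ /=; rewrite ?orbT //.
case: (ltgtP (lo u) (lo v)) => _ /=; rewrite ?orbT //.
by rewrite -val_eqE /=; case: ltngtP.
Qed.

(** Adjacent vertices lie in equal or consecutive layers, and the block number changes only across a
    layer of residue q. *)
Lemma adjacent_block u v : G u v -> res u != q -> res v != q -> block u = block v.
Proof.
move=> uv uq vq.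
have D := realizes_radial r0 Gc uv.
have D' := realizes_radial r0 Gc (etrans (realizes_sym Gc v u) uv).
have [L1 L2] : (layer v <= (layer u).+1)%N /\ (layer u <= (layer v).+1)%N.
  split; rewrite -ltnS -addn2 ltnNge; apply/negP => /(layer_gap L); rewrite /dist.
    by rewrite ltNge D.
  by rewrite ltNge D'.
have := res_lt L u; have := res_lt L v; have := residue_lt L.
move: L1 L2 uq vq; rewrite /layer /block.
move: (quo u) (quo v) (res u) (res v) => a b x y L1 L2 /eqP xq /eqP yq qM yM xM.
have [ab|[ab|ab]] : a = b \/ a = b.+1 \/ b = a.+1 by nia.
- by subst b; congr (_ + nat_of_bool _)%N; apply/idP/idP; lia.
(* The residue wraps: y = M - 1 and x = 0. The unit added to [quo v] compensates for the larger
   [quo u]. *)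
- subst a; have -> : (q < x)%N = false by nia.
  have -> : (q < y)%N = true by nia.
  lia.
subst b; have -> : (q < y)%N = false by nia.
have -> : (q < x)%N = true by nia.
lia.
Qed.

Section Bags.
Variables (m : nat) (E : rel 'I_m) (X : 'I_m -> {set 'I_n}).
(** An equation, because m will be the output cell [out_size s]. Node n gets an empty bag, so that
    the tree is nonempty even for n = 0. *)
Hypotheses (mn : m = n.+1) (EE : forall i j, E i j = adjacent_nat i j).
Hypothesis XE : forall t w,
  w \in X t <-> exists2 u, rank before u = t & in_bag u w.

Let node u : 'I_m := cast_ord (esym mn) (inord (rank before u)).

Let nodeE u : node u = rank before u :> nat.
Proof. by rewrite /= inordK // ltnS ltnW // rank_ltn //; exact: before_irr. Qed.

Let in_bag_node u w : in_bag u w -> w \in X (node u).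
Proof. by move=> uw; apply/XE; exists u; rewrite ?nodeE. Qed.

Lemma in_bag_refl u : in_bag u u.
Proof. by rewrite /in_bag eqxx lexx inf_le_sup_angle //= orbT. Qed.

Lemma adjacent_in_bag u v : G u v ->
  (in_bag u u && in_bag u v) || (in_bag v u && in_bag v v).
Proof.
move=> uv; rewrite !in_bag_refl andbT /=.
have [vq|vq] := eqVneq (res v) q; first by rewrite /in_bag vq eqxx.
have [uq|uq] := eqVneq (res u) q; first by rewrite /in_bag uq eqxx orbT.
have vu : G v u by rewrite (realizes_sym Gc).
rewrite /in_bag (adjacent_block uv uq vq) eqxx /= /lo /hi.
rewrite (realizes_angles r0 Gc uv) (realizes_angles r0 Gc vu) !andbT.
by case: leP => [|/ltW ->]; rewrite ?orbT.
Qed.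

Lemma layered_treedec : is_treedec G E X.
Proof.
split.
- by apply: path_is_tree => //; rewrite mn.
- by move=> v; exists (node v); apply/in_bag_node/in_bag_refl.
- move=> u v /adjacent_in_bag/orP[]/andP[uu uv].
    by exists (node u); rewrite !in_bag_node.
  by exists (node v); rewrite !in_bag_node.
(* An undeleted w occupies an interval of nodes: the nodes of its block are consecutive, and [lo x]
   is squeezed between [lo u] and [lo v]. *)
move=> w; apply: (path_connected_in EE) => i j k /andP[ij jk]; rewrite !inE.
move=> /XE[u ui uw] /XE[v vk vw].
have jn : (j < n)%N.
  by rewrite (leq_ltn_trans jk) // -vk rank_ltn //; exact: before_irr.
have [x xj] := rank_surj before_irr before_trans before_total jn.
apply/XE; exists x; first exact: xj.
have [wq|wq] := eqVneq (res w) q; first by rewrite /in_bag wq eqxx.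
have rE := rankE before_irr before_trans before_total.
have rI := rank_inj before_irr before_trans before_total.
have [ux|ux] := eqVneq u x; first by rewrite -ux.
have [xv|xv] := eqVneq x v; first by rewrite xv.
move: ij; rewrite -ui -xj leq_eqVlt (inj_eq rI) (negbTE ux) rE /= => {}ux.
move: jk; rewrite -vk -xj leq_eqVlt (inj_eq rI) (negbTE xv) rE /= => {}xv.
move: uw vw; rewrite /in_bag (negbTE wq) /= => /and3P[/eqP wu wul uwh] /and3P[/eqP wv wvl vwh].
have bx : block x = block u.
  apply/eqP; rewrite eqn_leq; move: ux xv; rewrite /before -wu -wv.
  by case: (ltngtP (block w) (block x)).
move: ux xv; rewrite /before -wu -wv bx -wu eqxx ltnn /= => ux xv.
have ux' : lo u <= lo x by case/orP: ux => [/ltW //|/andP[/eqP-> _]].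
have xv' : lo x <= lo v by case/orP: xv => [/ltW //|/andP[/eqP-> _]].
by rewrite (le_trans wul ux') (le_trans xv' vwh).
Qed.

(** The factor [(1 < M)] matters: for M = 1 every vertex is deleted, and the second term would not
    be bounded by a multiple of sqrt((1 + r) n). *)
Lemma bag_alpha_bound t J : 4 * r + 2 * mesh r <= J%:R * mesh r ->
  (alpha G (X t) <= #|[set v | res v == q]| + (1 < M) * (M * (4 * (J * 4))))%N.
Proof.
move=> rJ; apply/bigmax_leqP => S /andP[SX St].
rewrite -(cardsID [set v | res v == q] S); apply: leq_add.
  exact/subset_leq_card/finset.subsetIr.
have [/finset.set0Pn[x]|/negbNE/eqP->] := boolP (S :\: [set v | res v == q] != finset.set0);
  last by rewrite cards0.
rewrite 2!inE => /andP[xq xS].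
have M2 : (1 < M)%N.
  move: xq (res_lt L x) (residue_lt L) => /eqP; lia.
have /XE[u ut _] := fintype.subsetP SX x xS.
have SP w : w \in S :\: [set v | res v == q] ->
    [&& block w == block u, lo w <= lo u & lo u <= hi w].
  rewrite !inE => /andP[/negbTE wq /(fintype.subsetP SX)/XE[u' u't]].
  have -> : u' = u.
    apply: (rank_inj before_irr before_trans before_total).
    by rewrite u't ut.
  by rewrite /in_bag wq.
rewrite M2 mul1n.
apply: (layered_packing r0 Gc (phi := lo u) (layer := fun v => Ordinal (res_lt L v))) => //.
- apply/forall_inP => a; rewrite inE => /andP[_ aS].
  apply/forall_inP => b; rewrite inE => /andP[_ bS].
  by have /forall_inP/(_ a aS)/forall_inP/(_ b bS) := St.
- by move=> w /SP/and3P[_ -> ->].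
move=> a b /SP/and3P[/eqP au _ _] /SP/and3P[/eqP bu _ _] /(congr1 val)/= ab.
apply: layer_width L _ _ _; rewrite /layer ab; congr (_ * _ + _)%N.
(* Within a block the residue determines the quotient, so residues serve as layer names in
   ['I_M]. *)
by move: au; rewrite -bu /block ab => /addIn.
Qed.

(* With B the right-hand root, the deleted vertices account for 4 B and the
   other ones for 16 * 35 * 2 B. *)
Lemma layered_treedec_alpha :
  (treedec_alpha G X)%:R <= 1200%:R * (Num.sqrt (r / tanh r) * Num.sqrt n%:R).
Proof.
have rp := r0; set B := _ * Num.sqrt _.
have B0 : 0 <= B by rewrite mulr_ge0 ?sqrtr_ge0.
have QB : n%:R * (1 + r) <= 3 * B ^+ 2.
  have rt : 0 <= r / tanh r by rewrite divr_ge0 // ltW // tanh_gt0.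
  rewrite exprMn !sqr_sqrtr //.
  have n0 : 0 <= n%:R :> R by [].
  by have := ler_wpM2l n0 (tanh_bound r0); rewrite mulrCA [n%:R * (_ / _)]mulrC.
have r32 : 0 <= 32 * (1 + r) by lra.
have /andP[J1 J2] := Num.Theory.truncn_itv r32.
(* [4 * r <= 32 * (1 + r) * mesh r]; of the three extra units one offsets the truncation and two
   cover [2 * mesh r]. *)
set J := (Num.truncn (32 * (1 + r))).+3.
have JE : J%:R = (Num.truncn (32 * (1 + r)))%:R + 3 :> R.
  by rewrite /J -addn3 natrD.
have rJ : 4 * r + 2 * mesh r <= J%:R * mesh r.
  have m0 := mesh_gt0 r0.
  have : 4 * r <= 32 * (1 + r) * mesh r.
    rewrite /mesh; have [r1|r1] := leP r 1; last lra.
    by have := mulr_ge0 (ltW rp) (ltW rp); lra.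
  rewrite JE => H; move: (ler_wpM2r (ltW m0) (ltW J2)) H.
  by rewrite -[(Num.truncn _).+1%:R]natr1; move: (Num.truncn _)%:R (mesh r) => j d; lra.
apply: (@le_trans _ _ (#|[set v | res v == q]| + (1 < M) * (M * (4 * (J * 4))))%N%:R).
  rewrite ler_nat; apply/bigmax_leqP => t _; exact: bag_alpha_bound.
rewrite natrD.
set k := #|_|.
(* M k <= n <= 4 M^2 (1 + r) gives (M k)^2 <= n^2 <= 4 M^2 n (1 + r), hence k^2 <= 4 n (1 + r) <= 12
   B^2. *)
have k_le : k%:R <= 4 * B.
  apply: le_of_sqr; first lra.
  have kM : M%:R * k%:R <= n%:R :> R by rewrite -natrM ler_nat; exact: deleted_small L.
  have M1 : 1 <= M%:R :> R by rewrite ler1n; have := residue_lt L; lia.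
  have := modulus_large L; rewrite -natr1.
  have : 0 <= n%:R :> R by []. have : 0 <= k%:R :> R by [].
  move: (k%:R) (M%:R : R) (n%:R : R) M1 kM QB => x y z y1 xy QB x0 z0 zy.
  have zy' : z <= 4 * y ^+ 2 * (1 + r).
    by apply: le_trans zy _; rewrite ler_wpM2r //; nra.
  have : (y * x) ^+ 2 <= 4 * y ^+ 2 * (z * (1 + r)).
    apply: (@le_trans _ _ (z ^+ 2)); last by have := ler_wpM2l z0 zy'; lra.
    by apply: lerXn2r; rewrite ?nnegrE // mulr_ge0 //; lra.
  rewrite exprMn; have y2 : 0 < y ^+ 2 by nra.
  have -> : 4 * y ^+ 2 * (z * (1 + r)) = y ^+ 2 * (4 * (z * (1 + r))) by ring.
  rewrite ler_pM2l //; nra.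
have m_le : ((1 < M) * (M * (4 * (J * 4))))%N%:R <= 1120 * B.
  have [M1|_] := ltnP 1 M; last by rewrite mul0n; lra.
  (* Its square is at most n (1 + r) <= 3 B^2. *)
  have : M%:R * (1 + r) <= 2 * B.
    apply: le_of_sqr; first lra.
    case: (modulus_small L) => [M1'|]; first by rewrite M1' in M1.
    by move: (n%:R) (M%:R) QB => x y; nra.
  rewrite mul1n !natrM.
  have : J%:R <= 35 * (1 + r) by rewrite JE; lra.
  have : 0 <= M%:R :> R by [].
  by move: (M%:R) (J%:R) => x y; nra.
have -> : 1200%:R = 1200 :> R by [].
lra.
Qed.

End Bags.
End LayeredDecomposition.

(** * Programs with bounded loops *)

(** With loops over the vertices only, termination is structural: the semantics becomes a recursive
    function [run], and the running time a syntactic function [cost]. *)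
Inductive prog :=
  | PSkip
  | PN of nat & nexp & nexp & nexp
  | PR of nat & nexp & nexp & rexp
  | PSeq of prog & prog
  | PIf of bexp & prog & prog
  | PFor of nat & prog.

(* [PFor x p] runs p with cell (0, 0) of array x ranging over the vertices. *)
Fixpoint compile (p : prog) : cmd :=
  match p with
  | PSkip => Skip
  | PN a i j e => NStore a i j e
  | PR a i j e => RStore a i j e
  | PSeq p1 p2 => Seq (compile p1) (compile p2)
  | PIf b p1 p2 => If b (compile p1) (compile p2)
  | PFor x p =>
      let cell := NLoad x (NConst 0) (NConst 0) in
      Seq (NStore x (NConst 0) (NConst 0) (NConst 0))
        (While (BNot (BNLe NSize cell))
          (Seq (compile p)
            (NStore x (NConst 0) (NConst 0) (NAdd cell (NConst 1)))))
  end.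

Fixpoint nwrites (p : prog) : seq nat :=
  match p with
  | PN a _ _ _ => [:: a]
  | PSeq p1 p2 | PIf _ p1 p2 => nwrites p1 ++ nwrites p2
  | PFor x p => x :: nwrites p
  | _ => [::]
  end.

Fixpoint rwrites (p : prog) : seq nat :=
  match p with
  | PR a _ _ _ => [:: a]
  | PSeq p1 p2 | PIf _ p1 p2 => rwrites p1 ++ rwrites p2
  | PFor _ p => rwrites p
  | _ => [::]
  end.

Fixpoint counters_ok (p : prog) : bool :=
  match p with
  | PSeq p1 p2 | PIf _ p1 p2 => counters_ok p1 && counters_ok p2
  | PFor x p => (x \notin nwrites p) && counters_ok p
  | _ => true
  end.

(** An upper bound: both branches of a test are charged. A loop pays two units per iteration for
    test and increment, and two more for initialization and the final test. *)
Fixpoint cost (p : prog) (n : nat) : nat :=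
  match p with
  | PSeq p1 p2 => cost p1 n + cost p2 n
  | PIf _ p1 p2 => (cost p1 n + cost p2 n).+1
  | PFor _ p => n * (cost p n + 2) + 2
  | _ => 1
  end.

Lemma cost_poly p : exists a d, forall n, (cost p n <= a * n ^ d + a)%N.
Proof.
(* The added 1 is needed for n = 0 and d = 0. *)
have D n d e : (n ^ d <= n ^ (d + e) + 1)%N.
  case: n => [|n]; first by case: d => [|d]; rewrite ?addn1 // exp0n.
  by rewrite (leq_trans _ (leq_addr _ _)) // leq_pexp2l // leq_addr.
have S p1 p2 : (exists a d, forall n, (cost p1 n <= a * n ^ d + a)%N) ->
    (exists a d, forall n, (cost p2 n <= a * n ^ d + a)%N) ->
    exists a d, forall n, ((cost p1 n + cost p2 n).+1 <= a * n ^ d + a)%N.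
  move=> [a1 [d1 H1]] [a2 [d2 H2]]; exists (2 * (a1 + a2) + 1)%N, (d1 + d2)%N => n.
  have := D n d1 d2; have := D n d2 d1; rewrite [(d2 + d1)%N]addnC.
  have := H1 n; have := H2 n.
  move: (n ^ d1)%N (n ^ d2)%N (n ^ (d1 + d2))%N (cost p1 n) (cost p2 n).
  nia.
elim: p => [|? ? ? ?|? ? ? ?|p1 IH1 p2 IH2|_ p1 IH1 p2 IH2|_ p [a [d H]]] /=;
  try by exists 1%N, 0%N.
- have [a [d H]] := S _ _ IH1 IH2.
  by exists a, d => n; apply: leq_trans (H n).
- exact: S.
exists (2 * a + 2)%N, d.+1 => n; rewrite expnS.
have : (n <= n * n ^ d)%N.
  by case: n => // n; rewrite leq_pmulr // expn_gt0.
have := H n; move: (n ^ d)%N (cost p n) => x y; nia.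
Qed.

Section Semantics.
Variables (R : realType) (I : input R).
Implicit Types (s t : state R) (p : prog).

Definition set_counter x i s : state R :=
  State (update (nmem s) x 0 0 i) (rmem s).

Fixpoint run (p : prog) (s : state R) : state R :=
  match p with
  | PSkip => s
  | PN a i j e => nstore I s a i j e
  | PR a i j e => rstore I s a i j e
  | PSeq p1 p2 => run p2 (run p1 s)
  | PIf b p1 p2 => if beval I s b then run p1 s else run p2 s
  | PFor x p =>
      iteri (in_size I) (fun i t => set_counter x i.+1 (run p t))
        (set_counter x 0 s)
  end.

Definition agree p t s : Prop :=
  (forall a, a \notin nwrites p -> nmem t a = nmem s a) /\
  (forall a, a \notin rwrites p -> rmem t a = rmem s a).

Lemma update_other (A : Type) (m : nat -> nat -> nat -> A) a i j x b :
  b != a -> update m a i j x b = m b.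
Proof.
move=> /negbTE ba; apply/funext => i'; apply/funext => j'.
by rewrite /update ba.
Qed.

Lemma iteri_ind (T : Type) (P : nat -> T -> Prop) m f (x : T) :
  P 0%N x -> (forall i y, (i < m)%N -> P i y -> P i.+1 (f i y)) -> P m (iteri m f x).
Proof.
move=> P0 PS; have : (m <= m)%N by [].
by elim: {-2}m => //= i IH im; apply: (PS _ _ im (IH (ltnW im))).
Qed.

Lemma run_agree p s : agree p (run p s) s.
Proof.
elim: p s => [|a i j e|a i j e|p1 IH1 p2 IH2|b p1 IH1 p2 IH2|x p IH] s /=;
  split=> [a'|a'] //=.
- by rewrite inE; exact: update_other.
- by rewrite inE; exact: update_other.
- by rewrite mem_cat negb_or => /andP[a1 a2]; rewrite (IH2 _).1 // (IH1 _).1.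
- by rewrite mem_cat negb_or => /andP[a1 a2]; rewrite (IH2 _).2 // (IH1 _).2.
- by rewrite mem_cat negb_or => /andP[a1 a2]; case: ifP; rewrite ?(IH2 _).1 ?(IH1 _).1.
- by rewrite mem_cat negb_or => /andP[a1 a2]; case: ifP; rewrite ?(IH2 _).2 ?(IH1 _).2.
- rewrite inE negb_or => /andP[ax ap].
  apply: (@iteri_ind _ (fun _ t => nmem t a' = nmem s a')) => [|i t _ <-] /=.
    exact: update_other.
  by rewrite update_other // (IH _).1.
move=> ap; apply: (@iteri_ind _ (fun _ t => rmem t a' = rmem s a')) => //=.
by move=> i t _ <-; rewrite (IH _).2.
Qed.

(** The value of the counter and the arrays that the body leaves alone are provided by the rule, so
    an invariant describes only what the body writes. *)
Lemma run_for (Inv : nat -> state R -> Prop) x p s :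
  Inv 0%N (set_counter x 0 s) ->
  (forall i t, (i < in_size I)%N -> nmem t x 0 0 = i -> agree (PFor x p) t s ->
     Inv i t -> Inv i.+1 (set_counter x i.+1 (run p t))) ->
  Inv (in_size I) (run (PFor x p) s).
Proof.
move=> Inv0 InvS.
pose P i t := [/\ nmem t x 0 0 = i, agree (PFor x p) t s & Inv i t].
suff [] : P (in_size I) (run (PFor x p) s) by [].
apply: iteri_ind => [|i t im [ti ts it]].
  split=> //=; first by rewrite /update !eqxx.
  split=> a //=; rewrite inE negb_or => /andP[ax _]; exact: update_other.
split; first by rewrite /= /update !eqxx.
- split=> a /=.
    rewrite inE negb_or => /andP[ax ap]; rewrite update_other //.
    by rewrite (run_agree p t).1 // ts.1 // inE negb_or ax.
  by move=> ap; rewrite (run_agree p t).2 // ts.2.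
exact: InvS.
Qed.

Lemma exec_run p s : counters_ok p ->
  exists2 k, (k <= cost p (in_size I))%N & exec I (compile p) s (run p s) k.
Proof.
elim: p s => [|a i j e|a i j e|p1 IH1 p2 IH2|b p1 IH1 p2 IH2|x p IH] s /=.
- by exists 1%N => //; constructor.
- by exists 1%N => //; constructor.
- by exists 1%N => //; constructor.
- move=> /andP[/(IH1 s)[k1 k1c e1] /(IH2 (run p1 s))[k2 k2c e2]].
  exists (k1 + k2)%N; first exact: leq_add.
  exact: ExecSeq e1 e2.
- move=> /andP[/(IH1 s)[k1 k1c e1] /(IH2 s)[k2 k2c e2]].
  case: ifP => bs.
    exists k1.+1; first by rewrite ltnS (leq_trans k1c) // leq_addr.
    by apply: ExecIf; rewrite bs.
  exists k2.+1; first by rewrite ltnS (leq_trans k2c) // leq_addl.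
  by apply: ExecIf; rewrite bs.
move=> /andP[xp okp].
pose f i t := set_counter x i.+1 (run p t); set N := in_size I.
pose st i := iteri i f (set_counter x 0 s).
have stx i : nmem (st i) x 0 0 = i by case: i => [|i]; rewrite /st /= /update !eqxx.
set W := While _ _.
have loop d i : (i + d = N)%N ->
    exists2 k, (k <= d * (cost p N + 2) + 1)%N & exec I W (st i) (st N) k.
  elim: d i => [|d IHd] i; [rewrite addn0 | rewrite addnS] => iN.
    by exists 1%N => //; rewrite iN; apply: ExecWhileF; rewrite /= stx leqnn.
  have [k2 k2c e2] := IHd i.+1 iN.
  have [k1 k1c e1] := IH (st i) okp; rewrite -/N in k1c.
  exists (k1 + 1 + k2).+1.
    by move: k1c k2c; rewrite mulSn; move: (cost p N) (d * _)%N; lia.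
  apply: ExecWhileT e2; first by rewrite /= stx -ltnNge; lia.
  apply: ExecSeq e1 _.
  have -> : st i.+1 = nstore I (run p (st i)) x (NConst 0) (NConst 0)
      (NAdd (NLoad x (NConst 0) (NConst 0)) (NConst 1)).
    by rewrite /nstore /= (run_agree p (st i)).1 // stx addn1.
  constructor.
have [k kc e] := loop N 0%N (add0n N).
exists (1 + k)%N; first by move: kc; rewrite /N; lia.
apply: ExecSeq e; exact: ExecNStore.
Qed.
End Semantics.

Arguments run {R} I p s : simpl never.

(** * The algorithm *)

Definition scalar a := NLoad a (NConst 0) (NConst 0).
Definition entry a x := NLoad a x (NConst 0).
Definition assign a e := PN a (NConst 0) (NConst 0) e.
Definition assign_entry a x e := PN a x (NConst 0) e.
Definition is_zero e := BNLe e (NConst 0).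
Definition beq e1 e2 := BAnd (BNLe e1 e2) (BNLe e2 e1).
Definition bor b1 b2 := BNot (BAnd (BNot b1) (BNot b2)).
Definition succ e := NAdd e (NConst 1).
Definition base := RLoad 0 (NConst 0) (NConst 0).
Definition outer := scalar 20.
Definition inner := scalar 21.

(* Array 3: modulus M; 4: flags of the vertices already in a layer; 5 and 6:
   residue and quotient of the layer modulo M; 7 and 8: those of the layer in
   progress; 9: flag telling whether a base was found; 10: size of a residue
   class; 11: deleted residue; 12: block; 13: rank.  Real array 0 holds the
   least radial coordinate in the layer in progress. *)
Definition choose_modulus :=
  PSeq (assign 3 (NConst 1))
  (PFor 20
    (PIf (BRLe (RMul (RMul (RNat (succ outer)) (RNat (succ outer)))
                 (RAdd (RNat (NConst 1)) RRadius)) (RNat NSize))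
      (assign 3 (succ outer)) PSkip)).

(** The flag replaces an infinite initial minimum. Once every vertex is in a layer [base] keeps an
    old value, harmlessly, as [fill_layer] then changes nothing. *)
Definition find_base :=
  PFor 21
    (PIf (BAnd (is_zero (entry 4 inner))
            (bor (is_zero (scalar 9)) (BNot (BRLe base (RDist inner)))))
       (PSeq (PR 0 (NConst 0) (NConst 0) (RDist inner)) (assign 9 (NConst 1)))
       PSkip).

Definition fill_layer :=
  PFor 21
    (PIf (BAnd (is_zero (entry 4 inner))
            (BNot (BRLe (RAdd base (RAdd RRadius RRadius)) (RDist inner))))
       (PSeq (assign_entry 4 inner (NConst 1))
         (PSeq (assign_entry 5 inner (scalar 7)) (assign_entry 6 inner (scalar 8))))
       PSkip).

(** Quotient and residue are maintained as two counters, since the machine has no integer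
    division. *)
Definition next_layer :=
  PSeq (assign 7 (succ (scalar 7)))
    (PIf (BNLe (scalar 3) (scalar 7))
       (PSeq (assign 7 (NConst 0)) (assign 8 (succ (scalar 8)))) PSkip).

Definition assign_layers :=
  PFor 20 (PSeq (assign 9 (NConst 0)) (PSeq find_base (PSeq fill_layer next_layer))).

Definition count_residue :=
  PSeq (assign 10 (NConst 0))
    (PFor 21 (PIf (beq (entry 5 inner) outer) (assign 10 (succ (scalar 10))) PSkip)).

(** The product is formed in the reals because integer expressions have no multiplication. *)
Definition choose_residue :=
  PFor 20 (PSeq count_residue
    (PIf (BAnd (BNLe (succ outer) (scalar 3))
            (BRLe (RMul (RNat (scalar 3)) (RNat (scalar 10))) (RNat NSize)))
       (assign 11 outer) PSkip)).

Definition compute_blocks :=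
  PFor 20 (PSeq (assign_entry 12 outer (entry 6 outer))
    (PIf (BNLe (succ (scalar 11)) (entry 5 outer))
       (assign_entry 12 outer (succ (entry 6 outer))) PSkip)).

Definition before_test u v :=
  bor (BNLe (succ (entry 12 u)) (entry 12 v))
    (BAnd (beq (entry 12 u) (entry 12 v))
      (bor (BNot (BRLe (RInfAngle v) (RInfAngle u)))
         (BAnd (BAnd (BRLe (RInfAngle u) (RInfAngle v)) (BRLe (RInfAngle v) (RInfAngle u)))
            (BNLe (succ u) v)))).

Definition compute_ranks :=
  PFor 20 (PFor 21
    (PIf (before_test inner outer)
       (assign_entry 13 outer (succ (entry 13 outer))) PSkip)).

Definition bag_test u w :=
  bor (beq (entry 5 w) (scalar 11))
    (BAnd (beq (entry 12 w) (entry 12 u))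
      (BAnd (BRLe (RInfAngle w) (RInfAngle u)) (BRLe (RInfAngle u) (RSupAngle w)))).

Definition compute_bags :=
  PFor 20 (PFor 21
    (PIf (bag_test outer inner) (PN 2 (entry 13 outer) inner (NConst 1)) PSkip)).

Definition write_path :=
  PSeq (PFor 20 (PSeq (PN 1 outer (succ outer) (NConst 1))
                      (PN 1 (succ outer) outer (NConst 1))))
    (assign 0 (succ NSize)).

Definition decompose :=
  PSeq choose_modulus (PSeq assign_layers (PSeq choose_residue
    (PSeq compute_blocks (PSeq compute_ranks (PSeq compute_bags write_path))))).

(** * Correctness of the stages of the program *)

Section Correctness.
Variables (R : realType) (r : R) (n : nat) (G : rel 'I_n) (c : 'I_n -> h2 R).
Implicit Types s t : state R.

Local Notation input := (encode r G c).
Local Notation run := (run input).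
Local Notation dist v := (hdist (@pole R) (c v)).

Lemma query_ord (A : Type) (x : A) (f : 'I_n -> A) (v : 'I_n) : query x f v = f v.
Proof. by rewrite /query valK. Qed.

Lemma for_loop (Inv : nat -> state R -> Prop) x p s :
  Inv 0%N (set_counter x 0 s) ->
  (forall (i : 'I_n) t, nmem t x 0 0 = i -> agree (PFor x p) t s ->
     Inv i t -> Inv i.+1 (set_counter x i.+1 (run p t))) ->
  Inv n (run (PFor x p) s).
Proof.
move=> Inv0 InvS; apply: (@run_for _ input Inv) => // i t iN.
exact: (InvS (Ordinal iN)).
Qed.

Lemma run_if b p1 p2 s :
  run (PIf b p1 p2) s = if beval input s b then run p1 s else run p2 s.
Proof. by []. Qed.

Lemma run_seq p1 p2 s : run (PSeq p1 p2) s = run p2 (run p1 s).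
Proof. by []. Qed.

Lemma run_pn a i j e s : run (PN a i j e) s = nstore input s a i j e.
Proof. by []. Qed.

Lemma run_pr a i j e s : run (PR a i j e) s = rstore input s a i j e.
Proof. by []. Qed.

Lemma run_skip s : run PSkip s = s.
Proof. by []. Qed.

Definition runE := (run_if, run_seq, run_pn, run_pr, run_skip).

Lemma choose_modulus_correct s (M := nmem (run choose_modulus s) 3 0 0) : 0 < r ->
  [/\ (0 < M)%N, M = 1%N \/ (M <= n)%N,
      M = 1%N \/ M%:R ^+ 2 * (1 + r) <= n%:R :> R &
      n%:R <= M.+1%:R ^+ 2 * (1 + r) :> R].
Proof.
move=> r0; rewrite {}/M /choose_modulus run_seq.
set s1 := run _ s; set p := PIf _ _ _.
pose Inv i t := let M := nmem t 3 0 0 in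
  [/\ (0 < M)%N, M = 1%N \/ ((M <= i)%N /\ M%:R ^+ 2 * (1 + r) <= n%:R :> R) &
   forall m, (M < m <= i)%N -> n%:R <= m%:R ^+ 2 * (1 + r) :> R].
have : Inv n (run (PFor 20 p) s1).
  apply: for_loop => [|i t ti _ [M0 M1 M2]].
    by split=> //; [left | move=> m /andP[m0 m1]; move: (leq_trans m0 m1)].
  rewrite runE /= ti; case: ifP => /= H; rewrite runE /Inv /= /update /= ?ti ?addn1.
    split=> //; first by right; split=> //; rewrite expr2 -[i.+1]addn1.
    by move=> m /andP[m0 m1]; move: (leq_trans m0 m1); rewrite ltnn.
  split=> //.
    by case: M1 => [->|[le H1]]; [left|right; split=> //; exact: leqW].
  move=> m /andP[m0]; rewrite leq_eqVlt => /orP[/eqP->|m1]; last first.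
    by apply: M2; rewrite m0.
  by move/negbT: H; rewrite -ltNge -[i.+1]addn1 => /ltW; rewrite expr2.
rewrite /Inv /=; move: (nmem _ _ _ _) => M [M0 M1 M2].
split=> //; try by case: M1 => [|[]]; [left|right].
case: (leqP M.+1 n) => [Mn|nM]; first by apply: M2; rewrite ltnSn.
(* Beyond the range of the loop the bound is trivial: n <= M + 1 <= (M + 1)^2 (1 + r). *)
have nM' : n%:R <= M.+1%:R :> R by rewrite ler_nat ltnW.
have M1' : 1 <= M.+1%:R :> R by rewrite ler1n.
by move: (n%:R : R) (M.+1%:R : R) nM' M1' => x y; nra.
Qed.

(* The state reached when layers 0, ..., i - 1 are complete. *)
Record partial_layering i (assigned : 'I_n -> bool) (lay : 'I_n -> nat) : Prop := {
  partial_lt : forall v, assigned v -> (lay v < i)%N;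
  partial_above : forall u v, assigned u -> ~~ assigned v -> dist u < dist v;
  partial_far : forall u v, assigned u -> ~~ assigned v -> (lay u + 2 <= i)%N ->
    dist u + 2 * r < dist v;
  partial_width : forall u v, assigned u -> assigned v -> lay u = lay v ->
    dist u < dist v + 2 * r;
  partial_gap : forall u v, assigned u -> assigned v -> (lay u + 2 <= lay v)%N ->
    dist u + 2 * r < dist v;
  partial_count : forall v, ~~ assigned v -> (i <= #|assigned|)%N }.

(** The base b is required to be a minimum only if an unassigned vertex remains; otherwise its value
    is arbitrary and nothing changes. *)
Lemma partial_layering_step i as1 lay1 as2 lay2 (b : R) :
  0 < r ->
  partial_layering i as1 lay1 ->
  (forall v, ~~ as1 v -> b <= dist v) ->
  (forall v, ~~ as1 v -> exists2 u, ~~ as1 u & dist u = b) ->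
  (forall v, as2 v = as1 v || (dist v < b + 2 * r)) ->
  (forall v, as2 v -> lay2 v = if as1 v then lay1 v else i) ->
  partial_layering i.+1 as2 lay2.
Proof.
move=> r0 [P1 P2 P3 P4 P5 P6] bmin bex asE layE.
have as12 v : ~~ as2 v -> ~~ as1 v /\ b + 2 * r <= dist v.
  by rewrite asE negb_or -leNgt => /andP[].
have new v : as2 v -> ~~ as1 v -> b <= dist v < b + 2 * r.
  by rewrite asE => /orP[->//|bv nv]; rewrite bmin.
split.
- move=> v v2; rewrite layE //; case: ifP => // v1.
  exact: ltnW (P1 v v1).
- move=> u v u2 /as12[v1 bv]; have [u1|u1] := boolP (as1 u); first exact: P2.
  by have := new u u2 u1; lra.
- move=> u v u2 /as12[v1 bv]; rewrite layE //.
  have [u1 _|_] := boolP (as1 u); last by lia.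
  (* The vertex w realizing the base separates: u is before w, and what remains after the round is
     at least 2r beyond w. *)
  have [w w1 wb] := bex v v1.
  by have := P2 u w u1 w1; rewrite wb; lra.
- move=> u v u2 v2; rewrite !layE //.
  have [u1|u1] := boolP (as1 u); have [v1|v1] := boolP (as1 v).
  + exact: P4.
  + by move=> e; move: (P1 u u1); rewrite e ltnn.
  + by move=> e; move: (P1 v v1); rewrite e ltnn.
  by move: (new u u2 u1) (new v v2 v1); lra.
- move=> u v u2 v2; rewrite !layE //.
  have [u1|u1] := boolP (as1 u); have [v1|v1] := boolP (as1 v).
  + exact: P5.
  + exact: P3.
  + by have := P1 v v1; lia.
  by lia.
move=> v /as12[v1 bv]; have [w w1 wb] := bex v v1.
(* The base vertex itself enters the layer, so each round makes progress. *)
apply: leq_ltn_trans (P6 v v1) _; apply/proper_card/properP; split.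
  by apply/fintype.subsetP => x x1; rewrite unfold_in asE (_ : as1 x).
exists w; last by rewrite unfold_in.
by rewrite unfold_in asE wb ltrDl mulr_gt0 ?orbT.
Qed.

Lemma find_base_correct s (b := rmem (run find_base s) 0 0 0) :
  nmem s 9 0 0 = 0%N ->
  (forall v : 'I_n, nmem s 4 v 0 = 0%N -> b <= dist v) /\
  (forall v : 'I_n, nmem s 4 v 0 = 0%N ->
     exists2 u : 'I_n, nmem s 4 u 0 = 0%N & dist u = b).
Proof.
move=> s9; rewrite {}/b /find_base; set p := PIf _ _ _.
pose Inv j t := let b := rmem t 0 0 0 in
  (nmem t 9 0 0 = 0%N -> forall v : 'I_n, (v < j)%N -> nmem s 4 v 0 <> 0%N) /\
  (nmem t 9 0 0 <> 0%N ->
   (exists2 u : 'I_n, nmem s 4 u 0 = 0%N & dist u = b) /\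
   (forall v : 'I_n, (v < j)%N -> nmem s 4 v 0 = 0%N -> b <= dist v)).
have : Inv n (run (PFor 21 p) s).
  apply: for_loop => [|j t tj ag [I0 I1]]; first by split=> //=; rewrite /update /= s9.
  have t4 : nmem t 4 = nmem s 4 by exact: ag.1.
  have split_lt (v : 'I_n) : (v < j.+1)%N -> (v < j)%N \/ v = j.
    by rewrite ltnS leq_eqVlt => /orP[/eqP/val_inj->|]; [right|left].
  rewrite runE /= tj t4 query_ord leqn0; case: ifP => [|/negbT].
    move=> /andP[/eqP j4 H]; rewrite runE /Inv /= /update /= tj query_ord; split=> // _.
    split; first by exists j.
    move=> v /split_lt[vj|->] v4 //.
    move: H; rewrite leqn0 negb_and !negbK => /orP[/eqP t9|H].
      by case: (I0 t9 v vj).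
    have [t9|/eqP t9] := eqVneq (nmem t 9 0 0) 0%N; first by case: (I0 t9 v vj).
    by have [_ /(_ v vj v4)] := I1 t9; move: H; rewrite -ltNge; lra.
  rewrite negb_and leqn0 !negbK => H; rewrite runE /Inv /= /update /=.
  split=> t9.
    move=> v /split_lt[vj|->]; first exact: I0.
    by move: H; rewrite t9 /= orbF => /eqP.
  have [I2 I3] := I1 t9; split=> // v /split_lt[vj|->] v4; first exact: I3.
  by move: H; rewrite v4 eqxx /= => /andP[].
rewrite /Inv /=; set t := run _ s => -[I0 I1].
have t9 (v : 'I_n) : nmem s 4 v 0 = 0%N -> nmem t 9 0 0 <> 0%N.
  by move=> v4 t9; exact: (I0 t9 v).
split=> v v4; have [ex le] := I1 (t9 v v4); first exact: le.
by [].
Qed.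

Lemma fill_layer_correct s (t := run fill_layer s) (b := rmem s 0 0 0) (v : 'I_n) :
  let hit := (nmem s 4 v 0 == 0%N) && (dist v < b + 2 * r) in
  [/\ nmem t 4 v 0 = if hit then 1%N else nmem s 4 v 0,
      nmem t 5 v 0 = if hit then nmem s 7 0 0 else nmem s 5 v 0 &
      nmem t 6 v 0 = if hit then nmem s 8 0 0 else nmem s 6 v 0].
Proof.
rewrite {}/t /fill_layer; set p := PIf _ _ _.
pose Inv j t := forall v : 'I_n,
  let hit := [&& (v < j)%N, nmem s 4 v 0 == 0%N & dist v < b + 2 * r] in
  [/\ nmem t 4 v 0 = if hit then 1%N else nmem s 4 v 0,
      nmem t 5 v 0 = if hit then nmem s 7 0 0 else nmem s 5 v 0 &
      nmem t 6 v 0 = if hit then nmem s 8 0 0 else nmem s 6 v 0].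
suff : Inv n (run (PFor 21 p) s) by move=> /(_ v); rewrite ltn_ord.
apply: for_loop => [|j t tj ag It] //.
have t7 : nmem t 7 = nmem s 7 by exact: ag.1.
have t8 : nmem t 8 = nmem s 8 by exact: ag.1.
have t0 : rmem t 0 = rmem s 0 by exact: ag.2.
have [j4 j5 j6] := It j; move: j4 j5 j6; rewrite ltnn /= => j4 j5 j6.
rewrite runE /= tj t0 query_ord leqn0 -/b -ltNge j4 -[r + r]mulr2n -mulr_natl.
case: ifP => H u; rewrite ?runE /Inv /= /update /= ?tj ?t7 ?t8 ?andbT.
  have [->|uj] := eqVneq u j; first by rewrite !eqxx ltnSn H.
  have -> : (u == j :> nat) = false by rewrite val_eqE; exact: negbTE.
  by rewrite ltnS leq_eqVlt val_eqE (negbTE uj); exact: It.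
rewrite ltnS leq_eqVlt val_eqE; have [->|uj] := eqVneq u j; last exact: It.
by rewrite H.
Qed.

Lemma assign_layers_correct s (M := nmem s 3 0 0) (t := run assign_layers s)
    (lay := fun v : 'I_n => (nmem t 6 v 0 * M + nmem t 5 v 0)%N) :
  0 < r -> (0 < M)%N -> (forall v, nmem s 4 v 0 = 0%N) ->
  nmem s 7 0 0 = 0%N -> nmem s 8 0 0 = 0%N ->
  [/\ forall v : 'I_n, (nmem t 5 v 0 < M)%N,
      forall u v, lay u = lay v -> dist u < dist v + 2 * r &
      forall u v, (lay u + 2 <= lay v)%N -> dist u + 2 * r < dist v].
Proof.
move=> r0 M0 s4 s7 s8; rewrite {}/lay {}/t /assign_layers; set p := PSeq _ _.
pose asg t (v : 'I_n) := nmem t 4 v 0 != 0%N.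
pose lay t (v : 'I_n) := (nmem t 6 v 0 * M + nmem t 5 v 0)%N.
pose Inv i t := [/\ (nmem t 7 0 0 < M)%N, (nmem t 8 0 0 * M + nmem t 7 0 0)%N = i,
   forall v : 'I_n, asg t v -> (nmem t 5 v 0 < M)%N &
   partial_layering i (asg t) (lay t)].
have : Inv n (run (PFor 20 p) s).
  apply: for_loop => [|i t ti ag [t7 t8 t5 P]].
    have A v : asg (set_counter 20 0 s) v = false by rewrite /asg /= /update /= s4.
    split; rewrite /= /update /= ?s7 ?s8 //; first by move=> v; rewrite A.
    by split=> [v|u v|u v|u v|u v|v]; rewrite ?A.
  have t3 : nmem t 3 0 0 = M by rewrite (ag.1 3%N).
  rewrite /p !run_seq; set t1 := run _ t.
  have [] := @find_base_correct t1 (erefl _); set t2 := run _ t1.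
  set b := rmem t2 0 0 0 => bmin bex.
  have ag2 : agree find_base t2 t1 := run_agree _ _ _.
  have t2E a : a \notin nwrites find_base -> a != 9%N -> nmem t2 a = nmem t a.
    by move=> a1 a9; rewrite ag2.1 //; exact: update_other.
  set t4 := run fill_layer t2.
  have t4E := @fill_layer_correct t2; rewrite -/t4 -/b in t4E.
  have ag4 : agree fill_layer t4 t2 := run_agree _ _ _.
  have e3 : nmem t4 3 0 0 = M by rewrite ag4.1 // t2E.
  have e7 : nmem t4 7 0 0 = nmem t 7 0 0 by rewrite ag4.1 // t2E.
  have e8 : nmem t4 8 0 0 = nmem t 8 0 0 by rewrite ag4.1 // t2E.
  have asgE v : asg t4 v = asg t v || (dist v < b + 2 * r).
    rewrite /asg; have [-> _ _] := t4E v; rewrite t2E //.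
    by have [v4|v4] := eqVneq (nmem t 4 v 0) 0%N; rewrite /= ?v4; case: (dist v < _).
  have layE v : asg t4 v -> lay t4 v = if asg t v then lay t v else i.
    rewrite asgE /lay /asg; have [_ -> ->] := t4E v; rewrite !t2E // => H.
    have [v4|//] := eqVneq (nmem t 4 v 0) 0%N.
    by move: H; rewrite /asg v4 eqxx /= => ->; rewrite t8.
  have resE v : asg t4 v -> (nmem t4 5 v 0 < M)%N.
    rewrite asgE /asg; have [_ -> _] := t4E v; rewrite !t2E // => H.
    have [v4|v4] := eqVneq (nmem t 4 v 0) 0%N; last exact: t5.
    by move: H; rewrite v4 eqxx /= => ->.
  have P' : partial_layering i.+1 (asg t4) (lay t4).
    apply: (partial_layering_step r0 P (b := b)) => // v.
    - by rewrite negbK => /eqP v4; apply: bmin; exact: v4.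
    rewrite negbK => /eqP v4; have [u u4 ub] := bex v v4.
    by exists u => //; rewrite negbK; apply/eqP.
  rewrite /next_layer !runE /= /update /= e3 e7.
  case: ifP => H; rewrite ?runE /= /Inv /= /update /= ?e7 ?e8 ?addn1.
    split=> //.
    by rewrite addn0 mulSn -t8; move: t7 H (nmem t 8 0 0 * M)%N; lia.
  split=> //; first by move/negbT: H; rewrite addn1 -ltnNge.
  by rewrite addnS t8.
rewrite /Inv; set t := run _ s => -[_ _ t5 P].
(* A vertex left over after n rounds would leave at most n - 1 assigned ones, against
   [partial_count]. *)
have all v : asg t v.
  have [//|nv] := boolP (asg t v).
  have := partial_count P nv; rewrite leqNgt => /negP[].
  rewrite -[ltnRHS]card_ord; apply/proper_card/properP.
  by split; [exact/fintype.subsetP | exists v => //; rewrite unfold_in].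
split=> [v|u v|u v]; first exact: t5 (all v).
- exact: (partial_width P (all u) (all v)).
exact: (partial_gap P (all u) (all v)).
Qed.

Lemma card_below_succ (P : pred 'I_n) (j : 'I_n) :
  #|[set v : 'I_n | (v < j.+1)%N && P v]| = (P j + #|[set v : 'I_n | (v < j)%N && P v]|)%N.
Proof.
rewrite (cardsD1 j) inE ltnSn /=; congr (_ + _)%N; apply: eq_card => v.
by rewrite !inE ltnS leq_eqVlt val_eqE; have [->|] := eqVneq v j; rewrite /= ?ltnn.
Qed.

Lemma card_below_all (P : pred 'I_n) :
  #|[set v : 'I_n | (v < n)%N && P v]| = #|[set v | P v]|.
Proof. by apply: eq_card => v; rewrite !inE ltn_ord. Qed.

Lemma card_below0 (P : pred 'I_n) : #|[set v : 'I_n | (v < 0)%N && P v]| = 0%N.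
Proof. by apply: eq_card0 => v; rewrite !inE. Qed.

Lemma count_residue_correct s :
  nmem (run count_residue s) 10 0 0 = #|[set v : 'I_n | nmem s 5 v 0 == nmem s 20 0 0]|.
Proof.
rewrite /count_residue run_seq; set s1 := run _ s; set p := PIf _ _ _.
pose P (v : 'I_n) := nmem s 5 v 0 == nmem s 20 0 0.
pose Inv j t := nmem t 10 0 0 = #|[set v : 'I_n | (v < j)%N && P v]|.
have : Inv n (run (PFor 21 p) s1); last by rewrite /Inv card_below_all.
apply: for_loop => [|j t tj ag]; first by rewrite /Inv card_below0.
have t5 : nmem t 5 = nmem s 5 by rewrite (ag.1 5%N) //= update_other.
have t20 : nmem t 20 = nmem s 20 by rewrite (ag.1 20%N) //= update_other.
rewrite /Inv card_below_succ /P => It.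
rewrite runE /= tj t5 t20 -eqn_leq; case: ifP => H;
  by rewrite runE /= /update /= It ?addn1.
Qed.

Lemma residue_pigeonhole (res : 'I_n -> nat) M : (0 < M)%N ->
  (forall v, (res v < M)%N) -> M = 1%N \/ (M <= n)%N ->
  exists2 q, (q < M)%N & (M * #|[set v | res v == q]| <= n)%N.
Proof.
move=> M0 resM _; have [/existsP[q H]|/existsPn H] :=
    boolP [exists q : 'I_M, M * #|[set v | res v == q]| <= n]%N.
  by exists q.
have S : (\sum_(q < M) #|[set v | res v == q]| = n)%N.
  transitivity (\sum_(v : 'I_n) 1)%N; last by rewrite sum1_card card_ord.
  rewrite (partition_big (fun v => Ordinal (resM v)) predT) //=.
  apply: eq_bigr => q _; rewrite sum1_card; apply: eq_card => v.
  by rewrite inE unfold_in.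
(* If all M classes failed, each would contribute at least n + 1 to M times the sum of their sizes,
   which is M n. *)
have : (M * n.+1 <= M * n)%N.
  rewrite -{2}S big_distrr /= -[leqLHS](_ : \sum_(q < M) n.+1 = _)%N.
    by apply: leq_sum => q _; rewrite ltnNge.
  by rewrite sum_nat_const card_ord.
by rewrite leq_pmul2l // ltnn.
Qed.

Lemma choose_residue_correct s (M := nmem s 3 0 0)
    (q := nmem (run choose_residue s) 11 0 0) :
  (0 < M)%N -> M = 1%N \/ (M <= n)%N -> (forall v : 'I_n, (nmem s 5 v 0 < M)%N) ->
  nmem s 11 0 0 = 0%N ->
  (q < M)%N /\ (M * #|[set v : 'I_n | nmem s 5 v 0 == q]| <= n)%N.
Proof.
move=> M0 Mn resM s11; rewrite {}/q /choose_residue; set p := PSeq _ _.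
pose good q := (M * #|[set v : 'I_n | nmem s 5 v 0 == q]| <= n)%N.
pose Inv i t := let q := nmem t 11 0 0 in
  (q < M)%N /\ forall q', (q' < i)%N -> (q' < M)%N -> good q' -> good q.
have : Inv n (run (PFor 20 p) s).
  apply: for_loop => [|i t ti ag [I0 I1]]; first by split=> //=; rewrite /update /= s11.
  rewrite /p run_seq; set t1 := run count_residue t.
  have t1E a : a \notin nwrites count_residue -> nmem t1 a = nmem t a.
    by move=> aw; rewrite (run_agree input count_residue t).1.
  have e3 : nmem t1 3 0 0 = M by rewrite t1E // (ag.1 3%N).
  have e20 : nmem t1 20 0 0 = i by rewrite t1E.
  have e10 : nmem t1 10 0 0 = #|[set v : 'I_n | nmem s 5 v 0 == i]|.
    by rewrite count_residue_correct ti (ag.1 5%N).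
  rewrite !runE /= e3 e20 e10 -natrM ler_nat addn1.
  case: ifP => H; rewrite ?runE /Inv /= /update /= ?e20.
    by case/andP: H => iM gi; split.
  rewrite t1E //; split=> // q'; rewrite ltnS leq_eqVlt => /orP[/eqP-> iM gi|]; last exact: I1.
  by move: H gi; rewrite iM /good /= => ->.
rewrite /Inv; set t := run _ s => -[qM H]; split=> //.
(* The loop tries residues below n only. For M = 1 the initial value 0 is correct even if n = 0; for
   M <= n the good residue is tried. *)
case: (Mn) => [M1|Mn'].
  by rewrite M1 mul1n; apply: leq_trans (max_card _) _; rewrite card_ord.
have [q' q'M gq'] := residue_pigeonhole M0 resM Mn.
exact: (H q' (leq_trans q'M Mn') q'M gq').
Qed.

Lemma compute_blocks_correct s (v : 'I_n) :
  nmem (run compute_blocks s) 12 v 0 = (nmem s 6 v 0 + (nmem s 11 0 0 < nmem s 5 v 0))%N.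
Proof.
rewrite /compute_blocks; set p := PSeq _ _.
pose Inv i t := forall v : 'I_n, (v < i)%N ->
  nmem t 12 v 0 = (nmem s 6 v 0 + (nmem s 11 0 0 < nmem s 5 v 0))%N.
suff : Inv n (run (PFor 20 p) s) by move=> /(_ v (ltn_ord v)).
apply: for_loop => [|i t ti ag It] // u.
have t5 : nmem t 5 = nmem s 5 by exact: ag.1.
have t6 : nmem t 6 = nmem s 6 by exact: ag.1.
have t11 : nmem t 11 = nmem s 11 by exact: ag.1.
rewrite ltnS leq_eqVlt val_eqE !runE /= /update /= ti t5 t11 addn1.
case: ifP => H; rewrite ?runE /= /update /= ti ?t6 val_eqE andbT;
  by have [-> _|_ /It ->] := eqVneq u i; rewrite ?H ?addn0.
Qed.

Lemma before_testE t eu ev (u v : 'I_n) : neval input t eu = u -> neval input t ev = v ->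
  beval input t (before_test eu ev) =
  (nmem t 12 u 0 < nmem t 12 v 0)%N || ((nmem t 12 u 0 == nmem t 12 v 0) &&
    ((inf_angle r (c u) < inf_angle r (c v)) ||
     ((inf_angle r (c u) == inf_angle r (c v)) && (u < v)%N))).
Proof.
move=> uE vE; rewrite /= uE vE !query_ord !addn1 -eqn_leq -eq_le -ltNge.
by rewrite !(negb_and, negb_or, negbK).
Qed.

Lemma compute_ranks_correct s (v : 'I_n) : (forall v, nmem s 13 v 0 = 0%N) ->
  nmem (run compute_ranks s) 13 v 0 = #|[set u : 'I_n |
  (nmem s 12 u 0 < nmem s 12 v 0)%N || ((nmem s 12 u 0 == nmem s 12 v 0) &&
    ((inf_angle r (c u) < inf_angle r (c v)) ||
     ((inf_angle r (c u) == inf_angle r (c v)) && (u < v)%N)))]|.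
Proof.
move=> s13; pose P (v u : 'I_n) :=
  (nmem s 12 u 0 < nmem s 12 v 0)%N || ((nmem s 12 u 0 == nmem s 12 v 0) &&
    ((inf_angle r (c u) < inf_angle r (c v)) ||
     ((inf_angle r (c u) == inf_angle r (c v)) && (u < v)%N))).
rewrite /compute_ranks; set p := PIf _ _ _.
pose Inv i t := forall v : 'I_n,
  nmem t 13 v 0 = if (v < i)%N then #|[set u | P v u]| else 0%N.
suff : Inv n (run (PFor 20 (PFor 21 p)) s) by move=> /(_ v); rewrite ltn_ord.
apply: for_loop => [|i t ti ag It]; first by move=> u; rewrite /= /update /= s13.
pose Inv2 j t' := forall v : 'I_n, nmem t' 13 v 0 =
  if v == i then #|[set u : 'I_n | (u < j)%N && P v u]| else nmem t 13 v 0.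
have : Inv2 n (run (PFor 21 p) t).
  apply: for_loop => [|j t' tj ag' It'] u.
    by rewrite card_below0 /= /update /=; case: eqP => // ->; rewrite It ltnn.
  have t12 : nmem t' 12 = nmem s 12 by rewrite (ag'.1 12%N) // (ag.1 12%N).
  have t20 : nmem t' 20 0 0 = i by rewrite (ag'.1 20%N).
  rewrite card_below_succ run_if (@before_testE t' inner outer j i tj t20) t12.
  rewrite -/(P i j); case: ifP => H; rewrite ?runE /= /update /= ?t20 ?andbT ?val_eqE !It'.
    by have [->|_] := eqVneq u i; rewrite /= ?eqxx ?H ?addn1.
  by have [->|_] := eqVneq u i; rewrite /= ?H.
move=> H u; rewrite /= /update /= H; have [->|ui] := eqVneq u i.
  by rewrite ltnSn card_below_all.
by rewrite It ltnS [in RHS]leq_eqVlt val_eqE (negbTE ui).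
Qed.

Lemma bag_testE t eu ew (u w : 'I_n) : neval input t eu = u -> neval input t ew = w ->
  beval input t (bag_test eu ew) =
  (nmem t 5 w 0 == nmem t 11 0 0) || [&& nmem t 12 w 0 == nmem t 12 u 0,
    inf_angle r (c w) <= inf_angle r (c u) & inf_angle r (c u) <= sup_angle r (c w)].
Proof.
move=> uE wE; rewrite /= uE wE !query_ord -!eqn_leq.
by rewrite !(negb_and, negb_or, negbK).
Qed.

Lemma compute_bags_correct s row (w : 'I_n) :
  (forall i j, nmem s 2 i j = 0%N) ->
  nmem (run compute_bags s) 2 row w <> 0%N <->
  exists2 u : 'I_n, nmem s 13 u 0 = row &
    (nmem s 5 w 0 == nmem s 11 0 0) || [&& nmem s 12 w 0 == nmem s 12 u 0,
    inf_angle r (c w) <= inf_angle r (c u) & inf_angle r (c u) <= sup_angle r (c w)].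
Proof.
move=> s2; pose P (u w : 'I_n) :=
  (nmem s 5 w 0 == nmem s 11 0 0) || [&& nmem s 12 w 0 == nmem s 12 u 0,
    inf_angle r (c w) <= inf_angle r (c u) & inf_angle r (c u) <= sup_angle r (c w)].
rewrite /compute_bags; set p := PIf _ _ _.
pose Inv i t := forall row (w : 'I_n), nmem t 2 row w <> 0%N <->
  exists2 u : 'I_n, nmem s 13 u 0 = row & (u < i)%N && P u w.
suff H : Inv n (run (PFor 20 (PFor 21 p)) s).
  by rewrite H; split=> -[u u1 u2]; exists u; rewrite ?ltn_ord // in u2 *.
apply: for_loop => [|i t ti ag It].
  by move=> row' w'; rewrite /= /update /= s2; split=> // -[].
pose Inv2 j t' := forall row (w : 'I_n), nmem t' 2 row w <> 0%N <->
  nmem t 2 row w <> 0%N \/ [/\ nmem s 13 i 0 = row, (w < j)%N & P i w].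
have : Inv2 n (run (PFor 21 p) t).
  apply: for_loop => [|j t' tj ag' It'] row' w'.
    by rewrite /= /update /=; split=> [|[|[]]] //; left.
  have t5 : nmem t' 5 = nmem s 5 by rewrite (ag'.1 5%N) // (ag.1 5%N).
  have t11 : nmem t' 11 = nmem s 11 by rewrite (ag'.1 11%N) // (ag.1 11%N).
  have t12 : nmem t' 12 = nmem s 12 by rewrite (ag'.1 12%N) // (ag.1 12%N).
  have t13 : nmem t' 13 = nmem s 13 by rewrite (ag'.1 13%N) // (ag.1 13%N).
  have t20 : nmem t' 20 0 0 = i by rewrite (ag'.1 20%N).
  rewrite run_if (@bag_testE t' outer inner i j t20 tj) t5 t11 t12 -/(P i j).
  case: ifP => H; rewrite ?runE /= /update /= ?t20 ?t13 ?tj ?val_eqE.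
    case: ifP => [/andP[/eqP rE /eqP wE]|/negbT N].
      by split=> // _; right; rewrite wE rE ltnSn.
    rewrite It'; split=> -[t2|[r1 w1 Pw]]; try (by left); right; split=> //.
      exact: ltnW.
    move: w1; rewrite ltnS leq_eqVlt => /orP[|//]; rewrite val_eqE => w1.
    by move: N; rewrite -r1 eqxx w1.
  rewrite It'; split=> -[t2|[r1 w1 Pw]]; try (by left); right; split=> //.
    exact: ltnW.
  move: w1; rewrite ltnS leq_eqVlt => /orP[|//]; rewrite val_eqE => /eqP w1.
  by move: Pw; rewrite w1 H.
move=> H row' w'; rewrite /= /update /= H It; split.
  move=> [[u u1 /andP[u2 u3]]|[i1 _ i2]]; first by exists u; rewrite // (leqW u2).
  by exists i; rewrite // ltnSn.
move=> [u u1 /andP[]]; rewrite ltnS leq_eqVlt val_eqE => /orP[/eqP uE|ui] Pu.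
  by right; rewrite -uE ltn_ord.
by left; exists u; rewrite // ui.
Qed.

Lemma write_path_correct s (t := run write_path s) :
  (forall i j, nmem s 1 i j = 0%N) ->
  nmem t 0 0 0 = n.+1 /\
  forall i j, (i <= n)%N -> (j <= n)%N -> (nmem t 1 i j != 0%N) = adjacent_nat i j.
Proof.
move=> s1; rewrite {}/t /write_path run_seq; set p := PSeq _ _.
pose Inv k t := forall i j, (nmem t 1 i j != 0%N) =
  ((i.+1 == j) && (i < k)%N) || ((j.+1 == i) && (j < k)%N).
have : Inv n (run (PFor 20 p) s).
  apply: for_loop => [|k t tk ag It] i j; first by rewrite /= /update /= s1 !andbF.
  rewrite !runE /= /update /= tk addn1.
  case: ifP => [/andP[/eqP-> /eqP->]|N1]; first by lia.
  case: ifP => [/andP[/eqP-> /eqP->]|N2]; first by lia.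
  by rewrite It; lia.
set t := run _ s => It; rewrite runE /= /update /= addn1; split=> // i j i_n j_n.
by rewrite It /adjacent_nat; lia.
Qed.

End Correctness.

Section Algorithm.
Variables (R : realType) (r : R) (n : nat) (G : rel 'I_n) (c : 'I_n -> h2 R).
Hypotheses (r0 : 0 < r) (Gc : realizes r G c).

Local Notation input := (encode r G c).
Local Notation s7 := (run input decompose (init R)).

Lemma decompose_correct :
  is_treedec G (out_tree s7) (out_bag n s7) /\
  (treedec_alpha G (out_bag n s7))%:R
    <= 1200%:R * (Num.sqrt (r / tanh r) * Num.sqrt n%:R).
Proof.
pose s1 := run input choose_modulus (init R).
pose s2 := run input assign_layers s1.
pose s3 := run input choose_residue s2.
pose s4 := run input compute_blocks s3.
pose s5 := run input compute_ranks s4.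
pose s6 := run input compute_bags s5.
pose s := run input write_path s6.
rewrite (_ : s7 = s) //.
(* Frame facts, which carry a stored value across the stages that do not write its array. *)
have f1 := run_agree input choose_modulus (init R).
have f2 := run_agree input assign_layers s1.
have f3 := run_agree input choose_residue s2.
have f4 := run_agree input compute_blocks s3.
have f5 := run_agree input compute_ranks s4.
have f6 := run_agree input compute_bags s5.
have f7 := run_agree input write_path s6.
have [M0 Mn Msmall Mlarge] := @choose_modulus_correct R r n G c (init R) r0.
rewrite -/s1 in M0 Mn Msmall Mlarge; set M := nmem s1 3 0 0 in M0 Mn Msmall Mlarge.
have z4 v : nmem s1 4 v 0 = 0%N by rewrite f1.1.
have z7 : nmem s1 7 0 0 = 0%N by rewrite f1.1.
have z8 : nmem s1 8 0 0 = 0%N by rewrite f1.1.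
have z11 : nmem s2 11 0 0 = 0%N by rewrite f2.1 // f1.1.
have [resM width gap] := @assign_layers_correct R r n G c s1 r0 M0 z4 z7 z8.
have M2 : nmem s2 3 0 0 = M by rewrite f2.1.
have := @choose_residue_correct R r n G c s2; rewrite M2.
move=> /(_ M0 Mn resM z11)[qM small].
pose q := nmem s3 11 0 0; pose res (v : 'I_n) := nmem s2 5 v 0.
pose quo (v : 'I_n) := nmem s2 6 v 0.
have L : layering r c M q quo res by split.
have blk (v : 'I_n) : nmem s4 12 v 0 = block q quo res v.
  by rewrite compute_blocks_correct (f3.1 5%N) // (f3.1 6%N).
have bef (u v : 'I_n) : ((nmem s4 12 u 0 < nmem s4 12 v 0)%N
   || ((nmem s4 12 u 0 == nmem s4 12 v 0) &&
    ((inf_angle r (c u) < inf_angle r (c v)) ||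
     ((inf_angle r (c u) == inf_angle r (c v)) && (u < v)%N)))) =
   before r c q quo res u v by rewrite !blk.
have rk (v : 'I_n) : nmem s5 13 v 0 = rank (before r c q quo res) v.
  rewrite compute_ranks_correct => [|w]; last by rewrite f4.1 // f3.1 // f2.1 // f1.1.
  by apply: eq_card => u; rewrite !inE bef.
have z1 i j : nmem s6 1 i j = 0%N.
  by rewrite f6.1 // f5.1 // f4.1 // f3.1 // f2.1 // f1.1.
have z2 i j : nmem s5 2 i j = 0%N.
  by rewrite f5.1 // f4.1 // f3.1 // f2.1 // f1.1.
have [sn sE] := @write_path_correct R r n G c s6 z1; rewrite -/s in sn sE.
have XE (t : 'I_(out_size s)) w : w \in out_bag n s t <->
    exists2 u, rank (before r c q quo res) u = t & in_bag r c q quo res u w.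
  rewrite inE f7.1 //; apply: iff_trans (iff_sym (rwP negP)) _.
  apply: iff_trans (iff_trans _ (@compute_bags_correct R r n G c s5 t w z2)) _.
    by split=> [H /eqP|H /eqP].
  have e5 : nmem s5 5 = nmem s2 5 by rewrite f5.1 // f4.1 // f3.1.
  have e11 : nmem s5 11 = nmem s3 11 by rewrite f5.1 // f4.1.
  have e12 : nmem s5 12 = nmem s4 12 by rewrite f5.1.
  rewrite e5 e11 e12; split=> -[u u1 u2]; exists u.
  - by rewrite -rk.
  - by move: u2; rewrite !blk.
  - by rewrite rk.
  by rewrite !blk.
have EE i j : out_tree s i j = adjacent_nat i j.
  by apply: sE; rewrite -ltnS -sn; exact: ltn_ord.
split; first exact: (layered_treedec r0 Gc L sn EE XE).
exact: (layered_treedec_alpha r0 Gc L sn XE).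
Qed.
End Algorithm.

(** * Tree decompositions under relabelling of the vertices *)

Section Transport.
Variables (V W : finType) (G : rel V) (G' : rel W) (g : V -> W).
Hypotheses (ginj : injective g) (gG : forall u v, G' (g u) (g v) = G u v).

Lemma treedec_preimset (T : finType) (E : rel T) (X : T -> {set W}) :
  is_treedec G' E X -> is_treedec G E (fun t => g @^-1: X t).
Proof.
move=> [TE cov edges conn]; split=> // [v|u v|u].
- by have [t vt] := cov (g v); exists t; rewrite inE.
- by rewrite -gG => /edges[t]; exists t; rewrite !inE.
have -> : [set t | u \in g @^-1: X t] = [set t | g u \in X t].
  by apply/setP => t; rewrite !inE.
exact: conn.
Qed.

Lemma alpha_preimset (A : {set W}) : (alpha G (g @^-1: A) <= alpha G' A)%N.
Proof.
apply/bigmax_leqP => S /andP[SA St]; rewrite -(card_imset _ ginj).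
apply: (bigop.bigmax_sup (g @: S)) => //; apply/andP; split.
  by apply/fintype.subsetP => _ /imsetP[v /(fintype.subsetP SA) vA ->]; rewrite inE in vA.
apply/forall_inP => _ /imsetP[u uS ->]; apply/forall_inP => _ /imsetP[v vS ->].
by rewrite gG; have /forall_inP/(_ u uS)/forall_inP/(_ v vS) := St.
Qed.

Lemma treealpha_le (T : finType) (E : rel T) (X : T -> {set W}) :
  is_treedec G' E X -> (treealpha G <= treedec_alpha G' X)%N.
Proof.
move=> /treedec_preimset td.
apply: (@leq_trans (treedec_alpha G (fun t => g @^-1: X t))).
  rewrite /treealpha; case: ex_minnP => k _; apply; apply/asboolP.
  by exists T, E, (fun t => g @^-1: X t).
by apply/bigmax_leqP => t _; apply: (bigop.bigmax_sup t) => //; exact: alpha_preimset.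
Qed.
End Transport.

Unset Implicit Arguments.
Set Strict Implicit.

Theorem corollary3p13 (R : realType) :
  exists C : nat,
    (forall (r : R) (V : finType) (G : rel V),
       0 < r -> hyperbolic_udg r G ->
       (treealpha G)%:R <= C%:R * (Num.sqrt (r / tanh r) * Num.sqrt #|V|%:R))
    /\
    (exists (P : cmd) (a d : nat),
       forall (r : R) (n : nat) (G : rel 'I_n) (c : 'I_n -> h2 R),
         0 < r -> realizes r G c ->
         exists (s : state R) (k : nat),
           [/\ exec (encode r G c) P (init R) s k,
               (k <= a * n ^ d + a)%N,
               is_treedec G (out_tree s) (out_bag n s) &
               (treedec_alpha G (out_bag n s))%:R
                 <= C%:R * (Num.sqrt (r / tanh r) * Num.sqrt n%:R)]).
Proof.
exists 1200%N; split.
  move=> r V G r0 [c Gc].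
  (* The program accepts vertex sets ['I_n] only, so it is run on a numbered copy of G and its bags
     are pulled back. *)
  pose G' : rel 'I_#|V| := fun i j => G (enum_val i) (enum_val j).
  have Gc' : realizes r G' (c \o enum_val).
    move=> i j; rewrite /G' Gc; split=> -[ij H]; split=> //.
      by move=> e; apply: ij; rewrite e.
    by move/enum_val_inj.
  have [td al] := decompose_correct r0 Gc'.
  apply: le_trans al; rewrite ler_nat.
  apply: (treealpha_le (g := enum_rank)) td; first exact: enum_rank_inj.
  by move=> u v; rewrite /G' !enum_rankK.
have [a [d cost_le]] := cost_poly decompose.
exists (compile decompose), a, d => r n G c r0 Gc.
have [k kc e] := @exec_run R (encode r G c) decompose (init R) isT.
have [td al] := decompose_correct r0 Gc.
exists (run (encode r G c) decompose (init R)), k; split=> //.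
exact: leq_trans kc (cost_le n).
Qed.
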